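(* Let $m>1$ and $b>0$, let $\mathbb H_{m,b}=\{(x,y)\in\mathbb R^2: x^2-\frac{y^2}{m^2}<b^2\}$, and let $\tau_{m,b}=\inf\{t\ge0:\mathbf W(t)\notin\mathbb H_{m,b}\}$ be the first exit time of planar Brownian motion $\mathbf W$ from $\mathbb H_{m,b}$. Then for all $(x,y)\in\mathbb H_{m,b}$, $$\mathbb E_{(x,y)}[\tau_{m,b}]=\frac{m^2(b^2-x^2)+y^2}{m^2-1}.$$
   Context: Planar Brownian motion: $\mathbf W(t)=(W_1(t),W_2(t))$ with independent one-dimensional Brownian coordinates (unit variance per unit time). $\mathbb E_{(x,y)}$ denotes expectation when $\mathbf W$ starts at $(x,y)$. *)

(* Defs.v *)
From HB Require Import structures.
From mathcomp Require Import all_boot all_order all_algebra.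
From mathcomp Require Import all_classical all_reals all_analysis.

Set Implicit Arguments.
Unset Strict Implicit.
Unset Printing Implicit Defensive.

Import Order.TTheory GRing.Theory Num.Theory.
Import numFieldNormedType.Exports.

Local Open Scope classical_set_scope.
Local Open Scope ring_scope.

(* Processes are families indexed by all of R, of which only the times t >= 0
   are ever constrained or used. *)

(* Taking some of the A i to be setT gives the product rule for all
   subfamilies. *)
Definition mutually_independent (d : measure_display) (T : measurableType d)
    (R : realType) (P : probability T R) (n : nat) (X : 'I_n -> T -> R) : Prop :=
  forall A : 'I_n -> set R, (forall i, measurable (A i)) ->
    P (\bigcap_(i in [set: 'I_n]) (X i @^-1` A i)) =
    (\prod_(i < n) P (X i @^-1` A i))%E.

Definition process_sigma_algebra (d : measure_display) (T : measurableType d)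
    (R : realType) (B : R -> T -> R) : set (set T) :=
  <<s \bigcup_(t in [set t : R | 0 <= t]) g_sigma_algebra_preimage (B t) >>.

Definition independent_processes (d : measure_display) (T : measurableType d)
    (R : realType) (P : probability T R) (B1 B2 : R -> T -> R) : Prop :=
  forall E F : set T,
    process_sigma_algebra B1 E -> process_sigma_algebra B2 F ->
    P (E `&` F) = (P E * P F)%E.

(* The second parameter of normal_prob is the standard deviation, so that an
   increment over [s, t] has variance t - s. *)
Record brownian_motion (d : measure_display) (T : measurableType d)
    (R : realType) (P : probability T R) (x : R) (B : R -> T -> R) : Prop := {
  bm_measurable : forall t : R, 0 <= t -> measurable_fun [set: T] (B t) ;
  bm_start : {ae P, forall w, B 0 w = x} ;
  bm_indep_increments : forall (n : nat) (t : nat -> R),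
    0 <= t 0%N -> {homo t : i j / (i <= j)%N >-> i <= j} ->
    mutually_independent P (fun (i : 'I_n) w => B (t i.+1) w - B (t i) w) ;
  bm_gaussian_increments : forall s t : R, 0 <= s -> s < t ->
    forall A : set R, measurable A ->
    pushforward P (fun w => B t w - B s w) A =
    normal_prob 0 (Num.sqrt (t - s)) A ;
  bm_continuous :
    {ae P, forall w, {within [set t : R | 0 <= t], continuous (B ^~ w)}}
}.

Record planar_brownian_motion (d : measure_display) (T : measurableType d)
    (R : realType) (P : probability T R) (z : R * R) (W : R -> T -> R * R) :
    Prop := {
  pbm_fst : brownian_motion P z.1 (fun t w => (W t w).1) ;
  pbm_snd : brownian_motion P z.2 (fun t w => (W t w).2) ;
  pbm_indep : independent_processes P (fun t w => (W t w).1)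
                                      (fun t w => (W t w).2)
}.

(* Equal to +oo if the path stays in D forever, since ereal_inf set0 = +oo. *)
Definition exit_time (T : Type) (R : realType) (W : R -> T -> R * R)
    (D : set (R * R)) (w : T) : \bar R :=
  ereal_inf (EFin @` [set t : R | 0 <= t /\ ~ D (W t w)]).

Definition hyperbolic_region (R : realType) (m b : R) : set (R * R) :=
  [set z | z.1 ^+ 2 - z.2 ^+ 2 / m ^+ 2 < b ^+ 2].

(* Main.v *)
From HB Require Import structures.
Require Import Defs.
From mathcomp Require Import all_boot all_order all_algebra.
From mathcomp Require Import all_classical all_reals all_analysis.
From mathcomp Require Import measurable_realfun.
From mathcomp Require Import ring lra.

Set Implicit Arguments.
Unset Strict Implicit.
Unset Printing Implicit Defensive.

Import Order.TTheory GRing.Theory Num.Theory.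
Import numFieldNormedType.Exports.

Local Open Scope classical_set_scope.
Local Open Scope ring_scope.

(** Put [M = m ^ 2], [be = b ^ 2] and [quad M be x y = M be - M x ^ 2 + y ^ 2].
The region is the set where [quad] is positive, and half the Laplacian of [quad]
is the constant [1 - M].  Hence [quad (W t) + (M - 1) t] is a martingale, [quad]
vanishes where the path leaves the region, and optional stopping suggests
[(M - 1) E tau = quad M be x y], which is the claim.  Two points need care:
stopping has to be justified at an unbounded time, and the exit time, an
infimum over uncountably many times, need not even be measurable.

Both are handled by observing the path only at the multiples of [2 ^- n].
Because [quad] is a polynomial of degree two, the martingale identity is exact
for the random walk so obtained ([quad_stopped_mean]); it only uses that each
increment is centred, has the right variance and is independent of the past.

- Upper bound ([mean_time_le]).  A walk may jump over the boundary, so [quad] can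
  be negative at its exit.  It drops from a positive value in one step, and
  fourth moments of the increments show that the expected overshoot up to a fixed
  time tends to [0] with the mesh.

- Lower bound ([mean_time_ge], [mean_limit_sup]).  Up to a fixed time [t], the
  loss is the expectation of the positive part of [quad] over the paths still
  inside at time [t], at most that of a constant plus the square of the second
  coordinate.  The stopped second coordinate has orthogonal increments, whose
  variance between [s] and [t] is the expected time spent inside between [s] and
  [t]; expected exit times being bounded by the first point, this is small for
  [s] large.  What remains involves the position at the fixed time [s] and the
  probability of surviving until [t], which tends to [0].

Finally, grid exit times are compared with [tau].  A grid exit is an exit, so
[tau] is below every grid exit time.  Conversely, by continuity, a path leaving
the region of parameter [b ^ 2] is strictly outside the region of any parameter
[be < b ^ 2] during some interval, which fine grids detect: the decreasing limit
of the grid exit times for [be] is at most [tau].  Letting [be] tend to [b ^ 2]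
closes the gap ([exit_time_expectation]).  As the integral of a nonnegative
function is the supremum of the integrals of the simple functions below it,
these comparisons determine the integral of [tau], measurable or not. *)

(** * Integrable real random variables *)

Lemma pow4_ge0 (R : realDomainType) (r : R) : 0 <= r ^+ 4.
Proof. by rewrite (exprM _ 2 2) sqr_ge0. Qed.

Section Expectation.
Context d (T : measurableType d) (R : realType) (P : probability T R).
Implicit Types f g : T -> R.

Definition L1 f := P.-integrable [set: T] (EFin \o f).

Definition Ex f : R := \int[P]_w f w.

Lemma L1_measurable f : L1 f -> measurable_fun [set: T] f.
Proof. by move=> /measurable_int /measurable_EFinP. Qed.

Lemma L1_le f g : measurable_fun [set: T] f ->
  (forall w, `|f w| <= g w) -> L1 g -> L1 f.
Proof.
move=> mf fg; apply: (le_integrable measurableT) => [|w _ /=].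
  exact/measurable_EFinP.
by rewrite lee_fin (le_trans (fg w)) // ler_norm.
Qed.

Lemma L1_cst c : L1 (fun=> c).
Proof. by apply: finite_measure_integrable_cst. Qed.

Lemma L1D f g : L1 f -> L1 g -> L1 (fun w => f w + g w).
Proof. by move=> lf lg; have := integrableD measurableT lf lg. Qed.

Lemma L1Z c f : L1 f -> L1 (fun w => c * f w).
Proof. by move=> lf; have := integrableZl measurableT c lf. Qed.

Lemma L1N f : L1 f -> L1 (fun w => - f w).
Proof. by move=> lf; have := integrableN lf. Qed.

Lemma L1_sum (I : Type) (s : seq I) (F : I -> T -> R) :
  (forall i, L1 (F i)) -> L1 (fun w => \sum_(i <- s) F i w).
Proof.
move=> lF; elim: s => [|i s IHs].
  by under eq_fun do rewrite big_nil; exact: L1_cst.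
by under eq_fun do rewrite big_cons; exact: L1D.
Qed.

Lemma Ex_ext f g : f =1 g -> Ex f = Ex g.
Proof. by move=> fg; apply: eq_Rintegral => w _. Qed.

Lemma ExD f g : L1 f -> L1 g -> Ex (fun w => f w + g w) = Ex f + Ex g.
Proof. by move=> lf lg; rewrite /Ex RintegralD. Qed.

Lemma ExZ c f : L1 f -> Ex (fun w => c * f w) = c * Ex f.
Proof. by move=> lf; rewrite /Ex RintegralZl. Qed.

Lemma Ex_cst c : Ex (fun=> c) = c.
Proof. rewrite /Ex Rintegral_cst // -[RHS]mulr1; congr (_ * _).
by rewrite -[RHS]/(fine 1%E); congr fine; exact: probability_setT. Qed.

Lemma Ex_sum (I : Type) (s : seq I) (F : I -> T -> R) :
  (forall i, L1 (F i)) ->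
  Ex (fun w => \sum_(i <- s) F i w) = \sum_(i <- s) Ex (F i).
Proof.
move=> lF; elim: s => [|i s IHs].
  by rewrite big_nil -[RHS](Ex_cst 0); apply: Ex_ext => w; rewrite big_nil.
rewrite big_cons -IHs -ExD //; last exact: L1_sum.
by apply: Ex_ext => w; rewrite big_cons.
Qed.

Lemma Ex_le f g : L1 f -> L1 g -> (forall w, f w <= g w) -> Ex f <= Ex g.
Proof. by move=> lf lg fg; apply: le_Rintegral. Qed.

Lemma Ex_ge0 f : (forall w, 0 <= f w) -> 0 <= Ex f.
Proof. by move=> f0; apply: Rintegral_ge0. Qed.

Lemma ExE f : L1 f -> (\int[P]_w (f w)%:E)%E = (Ex f)%:E.
Proof. by move=> lf; rewrite /Ex /Rintegral fineK // integrable_fin_num. Qed.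

Lemma L1_ge0_lty f : measurable_fun [set: T] f -> (forall w, 0 <= f w) ->
  (\int[P]_w (f w)%:E < +oo)%E -> L1 f.
Proof.
move=> mf f0 foo; apply/integrableP; split; first exact/measurable_EFinP.
by under eq_integral do rewrite /= ger0_norm //.
Qed.

Lemma L1_sqr_of_pow4 f : measurable_fun [set: T] f ->
  L1 (fun w => f w ^+ 4) -> L1 (fun w => f w ^+ 2).
Proof.
move=> mf lf; apply: (@L1_le _ (fun w => 1 + f w ^+ 4)).
- exact: measurable_funX.
- move=> w; rewrite ger0_norm ?sqr_ge0 // (exprM _ 2 2).
  by have := sqr_ge0 (f w ^+ 2 - 1); rewrite sqrrB1; have := sqr_ge0 (f w); lra.
- by apply: L1D => //; exact: L1_cst.
Qed.

Lemma L1_of_pow4 f : measurable_fun [set: T] f ->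
  L1 (fun w => f w ^+ 4) -> L1 f.
Proof.
move=> mf lf; apply: (@L1_le _ (fun w => 1 + f w ^+ 2)) => //.
- by move=> w; rewrite ler_norml; apply/andP; split; nra.
- by apply: L1D; [exact: L1_cst|exact: L1_sqr_of_pow4].
Qed.

End Expectation.

(** * Moments of Gaussian variables *)
Section GaussianMoments.
Variable R : realType.
Local Notation mu := (@lebesgue_measure R).

(** The density only enters the definition of [normal_prob] through the measure
of sets; uniqueness of the Radon-Nikodym derivative carries it over to integrals. *)
Lemma ge0_integral_normal_prob (m s : R) (f : R -> \bar R) :
  (forall x, 0 <= f x)%E -> measurable_fun [set: R] f ->
  (\int[normal_prob m s]_x f x = \int[mu]_x (f x * (normal_pdf m s x)%:E))%E.
Proof.
move=> f0 mf.
have dom := @normal_prob_dominates R m s.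
rewrite -(@Radon_Nikodym_SigmaFinite.change_of_variables _ _ _
  (normal_prob m s) mu) //.
have iRN : mu.-integrable [set: R]
    (Radon_Nikodym_SigmaFinite.f (normal_prob m s) mu).
  exact: Radon_Nikodym_SigmaFinite.f_integrable.
apply: ae_eq_integral => //.
- by apply: emeasurable_funM => //; exact: (measurable_int mu).
- by apply: emeasurable_funM => //; apply/measurable_EFinP; exact: measurable_normal_pdf.
- apply: ae_eqe_mul2l; apply: integral_ae_eq => //.
    by apply/measurable_EFinP; exact: measurable_normal_pdf.
  by move=> E _ mE; rewrite -Radon_Nikodym_SigmaFinite.f_integral.
Qed.

(** Tilting a centred Gaussian density by the exponential of a square gives a
multiple of another one.  Parametrising the tilt by the ratio [r] of the two
standard deviations makes the multiple rational, so that the moments below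
come out without any integration by parts. *)
Lemma normal_pdf_tilt_sqr (s r x : R) : 0 < s -> 0 < r ->
  expR ((1 - r ^+ 2) / (s ^+ 2 *+ 2) * x ^+ 2) * normal_pdf 0 s x =
  r^-1 * normal_pdf 0 (s / r) x.
Proof.
move=> s0 r0; have sr0 : 0 < s / r by rewrite divr_gt0.
have s20 : s ^+ 2 != 0 by rewrite expf_neq0 // gt_eqF.
have r20 : r ^+ 2 != 0 by rewrite expf_neq0 // gt_eqF.
have peakE : r^-1 * normal_peak (s / r) = normal_peak s.
  rewrite /normal_peak -invfM -{1}(ger0_norm (ltW r0)) -sqrtr_sqr -sqrtrM ?sqr_ge0 //.
  congr (Num.sqrt _)^-1; field; rewrite ?lt0r_neq0 //.
rewrite !normal_pdfE ?gt_eqF // /normal_fun subr0 mulrCA [RHS]mulrA peakE -expRD.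
congr (_ * expR _); field; rewrite ?lt0r_neq0 //.
Qed.

Lemma normal_pdf_tilt (s t x : R) : 0 < s ->
  expR (t * x) * normal_pdf 0 s x =
  expR (t ^+ 2 * s ^+ 2 / 2) * normal_pdf (t * s ^+ 2) s x.
Proof.
move=> s0; have s0' : s != 0 by rewrite gt_eqF.
rewrite !normal_pdfE // /normal_fun mulrCA [RHS]mulrCA -!expRD.
congr (_ * expR _); field; exact: s0'.
Qed.

Lemma normal_mgf_sqr (s r : R) : 0 < s -> 0 < r ->
  (\int[normal_prob 0 s]_x (expR ((1 - r ^+ 2) / (s ^+ 2 *+ 2) * x ^+ 2))%:E =
   (r^-1)%:E)%E.
Proof.
move=> s0 r0; rewrite ge0_integral_normal_prob; last 2 first.
- by move=> x; rewrite lee_fin expR_ge0.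
- apply/measurable_EFinP/measurableT_comp => //.
  by apply: measurable_funM => //; exact: measurable_funX.
under eq_integral do rewrite -EFinM normal_pdf_tilt_sqr // EFinM.
rewrite ge0_integralZl //=; last 3 first.
- by apply/measurable_EFinP; exact: measurable_normal_pdf.
- by move=> x _; rewrite lee_fin normal_pdf_ge0.
- by rewrite lee_fin invr_ge0 ltW.
by rewrite integral_normal_pdf mule1.
Qed.

Lemma normal_mgf (s t : R) : 0 < s ->
  (\int[normal_prob 0 s]_x (expR (t * x))%:E =
   (expR (t ^+ 2 * s ^+ 2 / 2))%:E)%E.
Proof.
move=> s0; rewrite ge0_integral_normal_prob; last 2 first.
- by move=> x; rewrite lee_fin expR_ge0.
- by apply/measurable_EFinP/measurableT_comp => //; exact: measurable_funM.
under eq_integral do rewrite -EFinM normal_pdf_tilt // EFinM.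
rewrite ge0_integralZl ?lee_fin ?expR_ge0 //=; last 2 first.
- by apply/measurable_EFinP; exact: measurable_normal_pdf.
- by move=> x _; rewrite lee_fin normal_pdf_ge0.
by rewrite integral_normal_pdf mule1.
Qed.

End GaussianMoments.

Section GaussianVariable.
Context d (T : measurableType d) (R : realType) (P : probability T R).
Variables (X : T -> R) (s : R).
Hypotheses (mX : measurable_fun [set: T] X) (s_gt0 : 0 < s).
Hypothesis lawX :
  forall A, measurable A -> pushforward P X A = normal_prob 0 s A.

(** The two sides integrate over different structures of measurable type on [R]
with the same measurable sets, hence the detour through [measurableTypeR]. *)
Lemma gaussian_integral (f : R -> R) :
  (forall x, 0 <= f x) -> measurable_fun [set: R] f ->
  (\int[P]_w (f (X w))%:E = \int[normal_prob 0 s]_x (f x)%:E)%E.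
Proof.
move=> f0 mf; have mf' : measurable_fun [set: R] (EFin \o f).
  exact/measurable_EFinP.
pose Y : T -> measurableTypeR R := X.
have /= <- := @ge0_integral_pushforward _ _ T (measurableTypeR R) R Y mX P
  [set: R] (EFin \o f) measurableT mf' (fun x _ => f0 x).
have := @eq_measure_integral _ (measurableTypeR R) R [set: R]
  (normal_prob 0 s) (pushforward P Y) (EFin \o f).
by apply => // A mA _; exact: lawX.
Qed.

Lemma gaussian_L1 (f : R -> R) (b : R) :
  (forall x, 0 <= f x) -> measurable_fun [set: R] f ->
  (\int[normal_prob 0 s]_x (f x)%:E = b%:E)%E ->
  L1 P (f \o X) /\ Ex P (f \o X) = b.
Proof.
move=> f0 mf fb; have lf : L1 P (f \o X).
  apply: L1_ge0_lty => /=; first exact: measurableT_comp.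
    by move=> w; exact: f0.
  by rewrite gaussian_integral // fb ltry.
by split=> //; apply: EFin_inj; rewrite -ExE // gaussian_integral.
Qed.

Lemma gaussian_mgf_sqr (r : R) : 0 < r ->
  let f x := expR ((1 - r ^+ 2) / (s ^+ 2 *+ 2) * x ^+ 2) in
  L1 P (f \o X) /\ Ex P (f \o X) = r^-1.
Proof.
move=> r0 f; apply: gaussian_L1.
- by move=> x; exact: expR_ge0.
- apply: measurableT_comp => //.
  by apply: measurable_funM => //; exact: measurable_funX.
- exact: normal_mgf_sqr.
Qed.

Lemma gaussian_mgf (t : R) :
  let f x := expR (t * x) in
  L1 P (f \o X) /\ Ex P (f \o X) = expR (t ^+ 2 * s ^+ 2 / 2).
Proof.
move=> f; apply: gaussian_L1.
- by move=> x; exact: expR_ge0.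
- by apply: measurableT_comp => //; exact: measurable_funM.
- exact: normal_mgf.
Qed.

(** A fourth power is below an exponential of a square, and the latter has
expectation [2] at the ratio [r = 1 / 2].  The constant [64] is not sharp. *)
Lemma gaussian_moment4 : L1 P (fun w => X w ^+ 4) /\
  Ex P (fun w => X w ^+ 4) <= 64 * s ^+ 4.
Proof.
have [] := @gaussian_mgf_sqr 2^-1 ltac:(by rewrite invr_gt0).
set f := fun _ => _ => lf Ef.
have s20 : 0 < s ^+ 2 by rewrite exprn_gt0.
have le w : X w ^+ 4 <= 32 * s ^+ 4 * f (X w).
  (* The exponent is 3/8 (X/s)^2 at r = 1/2; a is half of it. *)
  set a := 3 / 16 * (X w ^+ 2 / s ^+ 2).
  have a0 : 0 <= a by rewrite mulr_ge0 ?divr_ge0 ?sqr_ge0.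
  have -> : f (X w) = expR a ^+ 2.
    rewrite -expRM_natl /f /a; congr expR; field; rewrite ?lt0r_neq0 //.
  have /lerXn2r : 1 + a <= expR a by exact: expR_ge1Dx.
  move=> /(_ 2%N); rewrite !nnegrE => /(_ _ _) a2.
  have {}a2 : a ^+ 2 <= expR a ^+ 2.
    apply: lerXn2r; rewrite ?nnegrE ?expR_ge0 //.
    by apply: le_trans (expR_ge1Dx a); lra.
  apply: (@le_trans _ _ (32 * s ^+ 4 * a ^+ 2)); last first.
    by apply: ler_wpM2l => //; rewrite mulr_ge0 // exprn_ge0 // ltW.
  rewrite [leRHS](_ : _ = (9 / 8) * X w ^+ 4); last first.
    by rewrite /a; field; rewrite ?lt0r_neq0 //.
  have : 0 <= X w ^+ 4 by rewrite pow4_ge0.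
  lra.
have lX : L1 P (fun w => X w ^+ 4).
  apply: (@L1_le _ _ _ _ _ (fun w => 32 * s ^+ 4 * f (X w))).
  - exact: measurable_funX.
  - by move=> w; rewrite ger0_norm // pow4_ge0.
  - exact: L1Z.
split=> //; apply: le_trans (Ex_le lX (L1Z _ lf) le) _.
by rewrite ExZ // Ef invrK mulrAC -natrM.
Qed.

Lemma gaussian_L1_sqr : L1 P (fun w => X w ^+ 2).
Proof. exact: L1_sqr_of_pow4 (gaussian_moment4.1). Qed.

Lemma gaussian_L1_id : L1 P X.
Proof. exact: L1_of_pow4 (gaussian_moment4.1). Qed.

(** Convexity of the exponential gives [1 + t * Ex P X <= expR (t^2 s^2 / 2)] for
all [t].  The right-hand side is [1] up to a term quadratic in [t], so a nonzero
mean would violate this for small [t] of its sign. *)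
Lemma gaussian_mean : Ex P X = 0.
Proof.
set e := Ex P X; apply/eqP/negP => /negP e0.
have key t : 1 + t * e <= expR (t ^+ 2 * s ^+ 2 / 2).
  have [lf <-] := gaussian_mgf t; have lX := L1Z t gaussian_L1_id.
  have <- : Ex P (fun w => 1 + t * X w) = 1 + t * e.
    by rewrite ExD ?Ex_cst ?ExZ //; [exact: gaussian_L1_id|exact: L1_cst].
  apply: Ex_le => //; first by apply: L1D => //; exact: L1_cst.
  by move=> w; exact: expR_ge1Dx.
have q0 : 0 < e ^+ 2 by rewrite exprn_even_gt0.
have S0 : 0 < s ^+ 2 by rewrite exprn_gt0.
(* The tilt t = l e, with l so small that l s^2 < 1 and l e^2 < 1. *)
set l := (s ^+ 2 + e ^+ 2 + 1)^-1.
have l0 : 0 < l by rewrite invr_gt0; lra.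
have lE : l * s ^+ 2 + l * e ^+ 2 + l = 1.
  by rewrite -mulrDr -[X in _ + X]mulr1 -mulrDr mulVf // gt_eqF //; lra.
have lS : 0 < l * s ^+ 2 by rewrite mulr_gt0.
have lq : 0 < l * e ^+ 2 by rewrite mulr_gt0.
have := key (l * e); set a := _ / 2.
have aE : a = (l * e ^+ 2) * (l * s ^+ 2) / 2 by rewrite /a; ring.
have -> : 1 + l * e * e = 1 + l * e ^+ 2 by ring.
have a1 : (1 - a) * expR a <= 1.
  rewrite -[leRHS](expRxMexpNx_1 (- a)) opprK ler_wpM2r ?expR_ge0 //.
  exact: expR_ge1Dx.
have a01 : 0 < 1 - a.
  by rewrite aE; nra.
move=> /(ler_wpM2l (ltW a01)) /le_trans /(_ a1).
rewrite aE; nra.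
Qed.

(** Convexity of the exponential gives
[0 <= (1 - r) * (2 s^2 - r (1 + r) Ex P (X^2))] for all [r > 0]: an upper bound on
the variance for [r < 1], a lower bound for [r > 1], and both tend to [s^2] as
[r] tends to [1]. *)
Lemma gaussian_variance : Ex P (fun w => X w ^+ 2) = s ^+ 2.
Proof.
set v := Ex P _; have lX := gaussian_L1_sqr.
have S0 : 0 < s ^+ 2 by rewrite exprn_gt0.
have v0 : 0 <= v by apply: Ex_ge0 => w; exact: sqr_ge0.
have key r : 0 < r -> 1 + (1 - r ^+ 2) / (s ^+ 2 *+ 2) * v <= r^-1.
  move=> r0; have [lf <-] := gaussian_mgf_sqr r0.
  set c := _ / _.
  have <- : Ex P (fun w => 1 + c * X w ^+ 2) = 1 + c * v.
    by rewrite ExD ?Ex_cst ?ExZ //; [exact: L1_cst|exact: L1Z].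
  apply: Ex_le => //; first by apply: L1D; [exact: L1_cst|exact: L1Z].
  by move=> w; exact: expR_ge1Dx.
have {}key r : 0 < r -> 0 <= (1 - r) * (2 * s ^+ 2 - r * (1 + r) * v).
  move=> r0; have := key _ r0; rewrite -subr_ge0 => h.
  have : 0 <= 2 * s ^+ 2 * r * (r^-1 - (1 + (1 - r ^+ 2) / (s ^+ 2 *+ 2) * v)).
    by rewrite mulr_ge0 // mulr_ge0 ?mulr_ge0 ?ltW.
  set A := (X in 0 <= X -> _); set B := (X in _ -> 0 <= X).
  by have -> : A = B by rewrite /A /B; field; rewrite ?lt0r_neq0.
apply/eqP; rewrite eq_le !leNgt; apply/andP; split; apply/negP => vS.
- have v1 : 0 < v by lra.
  set h := (v - s ^+ 2) / (3 * v).
  have h0 : 0 < h by rewrite divr_gt0 //; lra.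
  have hv : 3 * h * v = v - s ^+ 2 by rewrite /h; field; rewrite ?lt0r_neq0.
  have h1 : h < 1 by rewrite ltr_pdivrMr; lra.
  have := @key (1 - h) ltac:(lra); rewrite opprB addrC subrK pmulr_rge0 //.
  have : 0 <= h ^+ 2 * v by rewrite mulr_ge0 ?sqr_ge0 ?ltW.
  have -> : (1 - h) * (1 + (1 - h)) * v = 2 * v - 3 * h * v + h ^+ 2 * v by ring.
  by rewrite hv; lra.
- set h := (s ^+ 2 - v) / (4 * s ^+ 2).
  have h0 : 0 < h by rewrite divr_gt0 //; lra.
  have hS : 4 * h * s ^+ 2 = s ^+ 2 - v by rewrite /h; field; rewrite ?lt0r_neq0.
  have h1 : h < 1 by rewrite ltr_pdivrMr; lra.
  have := @key (1 + h) ltac:(lra).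
  rewrite opprD addrA subrr add0r mulNr oppr_ge0 pmulr_rle0 //.
  have : (3 * h + h ^+ 2) * v <= (4 * h) * s ^+ 2.
    by apply: ler_pM => //; [nra|nra|exact: ltW].
  have -> : (1 + h) * (1 + (1 + h)) * v = 2 * v + (3 * h + h ^+ 2) * v by ring.
  by rewrite hS; lra.
Qed.

End GaussianVariable.

(** * Independence from a generated sigma-algebra *)
Section Independence.
Context d (T : measurableType d) (R : realType) (P : probability T R).
Implicit Types (G : set (set T)) (f g X : T -> R).

Definition adapted G f :=
  measurable_fun [set: g_sigma_algebraType G] (f : g_sigma_algebraType G -> R).

Definition independent_from G X := forall E C, <<s G >> E -> measurable C ->
  P (E `&` X @^-1` C) = (P E * P (X @^-1` C))%E.

Lemma adapted_measurable G f : G `<=` measurable -> adapted G f ->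
  measurable_fun [set: T] f.
Proof.
move=> Gm af _ B mB.
have := af measurableT B mB; apply: smallest_sub => //.
exact: sigma_algebra_measurable.
Qed.

Lemma adapted_preimage G f C : adapted G f -> measurable C ->
  <<s G >> (f @^-1` C).
Proof. by move=> af mC; have := af measurableT C mC; rewrite setTI. Qed.

(** For fixed [C], both sides are finite measures as functions of [E]; two such
measures that agree on a pi-system agree on the sigma-algebra it generates. *)
Lemma independent_from_pi G X : measurable_fun [set: T] X ->
  G `<=` measurable -> setI_closed G -> G [set: T] ->
  (forall E C, G E -> measurable C ->
    P (E `&` X @^-1` C) = (P E * P (X @^-1` C))%E) ->
  independent_from G X.
Proof.
move=> mX Gm GI GT rule E C sGE mC.
have mXC : measurable (X @^-1` C) by rewrite -[_ @^-1` _]setTI; exact: mX.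
pose p : {nonneg R} := NngNum (fine_ge0 (measure_ge0 P (X @^-1` C))).
have pE : p%:num%:E = P (X @^-1` C) by rewrite /= fineK // fin_num_measure.
have cover : \bigcup_(k : nat) [set: T] = [set: T].
  by apply/seteqP; split=> // w _; exists 0%N.
have key : mrestr P mXC E = mscale p P E.
  apply: (@g_sigma_algebra_measure_unique d R T G Gm (fun=> [set: T]) (fun=> GT)
    cover (mrestr P mXC) (mscale p P) GI) => // [A GA|k].
    by rewrite [RHS]muleC pE; exact: rule.
  by rewrite -ge0_fin_numE // fin_num_measure.
by rewrite muleC -pE; exact: key.
Qed.

Lemma independent_from_comp G X (h : R -> R) : measurable_fun [set: R] h ->
  independent_from G X -> independent_from G (h \o X).
Proof.
move=> mh iX E C sE mC; rewrite comp_preimage; apply: iX => //.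
by rewrite -[_ @^-1` _]setTI; exact: mh.
Qed.

(** The joint law of the two variables is the product of their laws, so this is
Fubini's theorem for the product of the coordinates. *)
Lemma Ex_indep G f X : G `<=` measurable -> adapted G f ->
  measurable_fun [set: T] X -> independent_from G X -> L1 P f -> L1 P X ->
  L1 P (fun w => f w * X w) /\ Ex P (fun w => f w * X w) = Ex P f * Ex P X.
Proof.
move=> Gm af mX iX lf lX.
have mf := adapted_measurable Gm af.
pose D := Real_sort__canonical__measurable_structure_Measurable R.
pose f' : {mfun T >-> D} := HB.pack_for {mfun T >-> D} f
  (isMeasurableFun.Build _ _ T D f mf).
pose X' : {mfun T >-> D} := HB.pack_for {mfun T >-> D} X
  (isMeasurableFun.Build _ _ T D X mX).
pose Z : T -> D * D := fun w => (f w, X w).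
have mZ : measurable_fun [set: T] Z by exact: measurable_fun_pair.
pose Z' : {mfun T >-> (D * D)%type} := HB.pack_for {mfun T >-> (D * D)%type} Z
  (isMeasurableFun.Build _ _ T _ Z mZ).
pose m1 := distribution P f'; pose m2 := distribution P X'.
pose m := distribution P Z'.
have mE : forall A, measurable A -> (m1 \x m2)%E A = m A.
  apply: product_measure_unique => A B mA mB.
  rewrite /m /m1 /m2 /distribution /pushforward /= -iX //.
  exact: (adapted_preimage af mA).
pose h (z : D * D) : \bar R := (z.1 * z.2)%:E.
have mh : measurable_fun [set: D * D] h.
  by apply/measurable_EFinP; apply: measurable_funM.
have int1 : (\int[m1]_x `|x%:E| = (Ex P (fun w => `|f w|))%:E)%E.
  rewrite -ExE; last first.
    by have := integrable_norm lf.
  rewrite ge0_integral_distribution //.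
  exact: (@measurableT_comp _ _ _ _ _ _ abse _ EFin).
have int2 : (\int[m2]_x `|x%:E| = (Ex P (fun w => `|X w|))%:E)%E.
  rewrite -ExE; last first.
    by have := integrable_norm lX.
  rewrite ge0_integral_distribution //.
  exact: (@measurableT_comp _ _ _ _ _ _ abse _ EFin).
have ih : (m1 \x m2)%E.-integrable [set: D * D] h.
  apply/integrable12ltyP => //.
  rewrite (eq_integral (fun x : D => `|(x : R)%:E| * (Ex P (fun w => `|X w|))%:E)%E); last first.
    move=> x _; rewrite -int2 -ge0_integralZl //.
      by apply: eq_integral => y _; rewrite /h /= normrM EFinM.
    exact: (@measurableT_comp _ _ _ _ _ _ abse _ EFin).
  rewrite ge0_integralZr // ?int1 -?EFinM ?ltry //.
    exact: (@measurableT_comp _ _ _ _ _ _ abse _ EFin).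
  by rewrite lee_fin Ex_ge0.
have ihm : m.-integrable [set: D * D] h.
  move/integrableP : ih => [_ hoo]; apply/integrableP; split => //.
  rewrite -(@eq_measure_integral _ _ _ _ m (m1 \x m2)%E) // => A mA _; exact: mE.
have mhZ : measurable_fun [set: T] (fun w => f w * X w) by exact: measurable_funM.
have lfX : L1 P (fun w => f w * X w).
  move/integrableP : ihm => [_]; rewrite ge0_integral_distribution //; last first.
    exact: (@measurableT_comp _ _ _ _ _ _ abse _ h).
  by move=> hoo; apply/integrableP; split => //; exact/measurable_EFinP.
split=> //; apply: EFin_inj; rewrite -ExE //.
transitivity (\int[m]_z h z)%E; first by rewrite integral_distribution.
rewrite -(@eq_measure_integral _ _ _ _ m (m1 \x m2)%E) //; last by move=> A mA _; exact: mE.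
have i1 : m1.-integrable [set: D] EFin by apply/integrableP; rewrite int1 ltry.
have i2 : m2.-integrable [set: D] EFin by apply/integrableP; rewrite int2 ltry.
have E1 : (\int[m1]_x x%:E = (Ex P f)%:E)%E by rewrite integral_distribution // -ExE.
have E2 : (\int[m2]_x x%:E = (Ex P X)%:E)%E by rewrite integral_distribution // -ExE.
rewrite -integral12_prod_meas1 // /fubini_F.
rewrite (eq_integral (fun x : D => (x : R)%:E * (Ex P X)%:E)%E); last first.
  by move=> x _; rewrite -E2 -integralZl.
by rewrite integralZr // E1.
Qed.

End Independence.

(** * The second moment of a stopped sum *)

(** What the estimates on walks use of Brownian increments; the constant [64]
is the one of [gaussian_moment4]. *)
Record noise d (T : measurableType d) (R : realType) (P : probability T R)
    (G : nat -> set (set T)) (v : R) (xi : nat -> T -> R) : Prop := {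
  noise_adapted : forall i k, (i < k)%N -> adapted (G k) (xi i) ;
  noise_indep : forall k, independent_from P (G k) (xi k) ;
  noise_meas : forall k, measurable_fun [set: T] (xi k) ;
  noise_mean : forall k, Ex P (xi k) = 0 ;
  noise_var : forall k, Ex P (fun w => xi k w ^+ 2) = v ;
  noise_L4 : forall k, L1 P (fun w => xi k w ^+ 4) ;
  noise_moment4 : forall k, Ex P (fun w => xi k w ^+ 4) <= 64 * v ^+ 2
}.

Lemma indic_01 (T : Type) (R : realType) (B : set T) w :
  (\1_B w : R) = 0 \/ (\1_B w : R) = 1.
Proof. by rewrite indicE; case: (w \in B); [right|left]. Qed.

Lemma L1_indic d (T : measurableType d) (R : realType) (P : probability T R)
  (B : set T) : measurable B -> L1 P (\1_B).
Proof.
move=> mB; apply: (@L1_le _ _ _ _ _ (fun=> 1)) => //; last exact: L1_cst.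
by move=> w; case: (indic_01 R B w) => ->; rewrite ?normr0 ?normr1.
Qed.

Section StoppedSum.
Context d (T : measurableType d) (R : realType) (P : probability T R).
Variables (G : nat -> set (set T)) (A : nat -> set T) (xi : nat -> T -> R).
Variable v : R.
Hypothesis G_meas : forall k, G k `<=` measurable.
Hypothesis A_adapted : forall i k, (i <= k)%N -> <<s G k >> (A i).
Hypothesis xi_noise : noise P G v xi.

(** When [A i] is the event that a stopping time exceeds [i], this is for [J = 0]
the walk started at [c] with steps [xi], frozen at the stopping time, and for
[c = 0] the displacement of the frozen walk between [J] and [K]. *)
Definition stopped_sum (c : R) (J K : nat) (w : T) : R :=
  c + \sum_(J <= i < K) \1_(A i) w * xi i w.

Lemma adapted_indic i k : (i <= k)%N -> adapted (G k) (\1_(A i) : T -> R).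
Proof. by move=> ik; apply: measurable_indic; exact: A_adapted. Qed.

Lemma stopped_sumS c J K : (J <= K)%N ->
  stopped_sum c J K.+1 =
  (fun w => stopped_sum c J K w + \1_(A K) w * xi K w).
Proof. by move=> JK; apply/funext => w; rewrite /stopped_sum big_nat_recr //= addrA. Qed.

Lemma adapted_stopped_sum c J n k : (J + n <= k)%N ->
  adapted (G k) (stopped_sum c J (J + n)).
Proof.
elim: n k => [|n IHn] k.
  move=> _; rewrite addn0 (_ : stopped_sum _ _ _ = fun=> c); first exact: measurable_cst.
  by apply/funext => w; rewrite /stopped_sum big_geq // addr0.
rewrite addnS => Jnk; rewrite stopped_sumS ?leq_addr //.
apply: measurable_funD; first by apply: (IHn); exact: ltnW.
by apply: measurable_funM; [apply: adapted_indic; exact: ltnW|exact: (noise_adapted xi_noise)].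
Qed.

(** The summands are orthogonal: the step [xi K] is centred and independent of
[stopped_sum c J K * \1_(A K)], so the cross term has expectation [0]. *)
Lemma stopped_sum_moment c J n :
  let V := stopped_sum c J (J + n) in
  L1 P (fun w => V w ^+ 2) /\
  Ex P (fun w => V w ^+ 2) =
    c ^+ 2 + v * \sum_(J <= i < J + n) Ex P (\1_(A i)).
Proof.
elim: n => [|n []]; rewrite /=.
  rewrite addn0 big_geq // mulr0 addr0.
  rewrite (_ : (fun w => _) = fun=> c ^+ 2); first by rewrite Ex_cst; split=> //; exact: L1_cst.
  by apply/funext => w; rewrite /stopped_sum big_geq // addr0.
set K := (J + n)%N => lV EV; rewrite addnS -/K big_nat_recr ?leq_addr //=.
rewrite stopped_sumS ?leq_addr //; set V := stopped_sum c J K.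
have aV : adapted (G K) V by exact: adapted_stopped_sum.
have mV : measurable_fun [set: T] V by exact: adapted_measurable aV.
have mxi := noise_meas xi_noise K.
have lxi2 := L1_sqr_of_pow4 mxi (noise_L4 xi_noise K).
have mA : measurable (A K).
  by apply: smallest_sub (A_adapted (leqnn K)) => //; exact: sigma_algebra_measurable.
have lA := L1_indic P mA.
have lVA : L1 P (fun w => 2 * V w * \1_(A K) w).
  apply: (@L1_le _ _ _ _ _ (fun w => 1 + V w ^+ 2)).
  - by apply: measurable_funM => //; exact: measurable_funM.
  - move=> w; case: (indic_01 R (A K) w) => ->.
      by rewrite mulr0 normr0 addr_ge0 // sqr_ge0.
    have := sqr_ge0 (V w + 1); have := sqr_ge0 (V w - 1).
    by rewrite mulr1 ler_norml => h1 h2; apply/andP; split; lra.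
  - by apply: L1D => //; exact: L1_cst.
have aVA : adapted (G K) (fun w => 2 * V w * \1_(A K) w).
  apply: measurable_funM; last exact: adapted_indic.
  exact: measurable_funM.
have [l1 E1] := Ex_indep (@G_meas K) aVA mxi (noise_indep xi_noise (k:=K)) lVA
  (L1_of_pow4 mxi (noise_L4 xi_noise K)).
have [l2 E2] := Ex_indep (@G_meas K) (adapted_indic (leqnn K))
  (measurable_funX 2 mxi)
  (independent_from_comp (measurable_funX 2 (@measurable_id _ _ _)) (noise_indep xi_noise (k:=K)))
  lA lxi2.
have -> : (fun w => (V w + \1_(A K) w * xi K w) ^+ 2) =
  (fun w => V w ^+ 2 + (2 * V w * \1_(A K) w * xi K w + \1_(A K) w * xi K w ^+ 2)).
  by apply/funext => w; case: (indic_01 R (A K) w) => ->; ring.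
split; first by apply: L1D => //; exact: L1D.
rewrite ExD ?ExD //; last exact: L1D.
by rewrite EV E1 E2 (noise_mean xi_noise) (noise_var xi_noise); ring.
Qed.

End StoppedSum.

(** * Exit of a random walk from the region *)

(** With [M = m ^ 2] and [be = b ^ 2] this is [m ^ 2] times the function whose
positivity defines the hyperbolic region. *)
Definition quad (R : realType) (M be x y : R) : R := M * be - M * x ^+ 2 + y ^+ 2.

Definition walk (T : Type) (R : realType) (c : R) (xi : nat -> T -> R) (k : nat)
  (w : T) : R := c + \sum_(0 <= i < k) xi i w.

(** This inequality and the next one trade a small constant against a fourth
power.  Summed over a grid of mesh [v], fourth powers of increments are of
order [v], while their squares do not become small. *)
Lemma le_eps_pow4 (R : realType) (e r : R) : 0 < e -> `|r| <= e + r ^+ 4 / e ^+ 3.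
Proof.
move=> e0; rewrite -lerBlDl ler_pdivlMr ?exprn_gt0 //.
have -> : r ^+ 4 = `|r| ^+ 4 by rewrite -normrX ger0_norm // pow4_ge0.
have [re|er] := leP `|r| e.
  apply: (@le_trans _ _ 0); last by rewrite exprn_ge0.
  by rewrite mulr_le0_ge0 ?subr_le0 // exprn_ge0 // ltW.
rewrite [leRHS]exprS; apply: ler_pM.
- by rewrite subr_ge0 ltW.
- by rewrite exprn_ge0 // ltW.
- by rewrite gerBl ltW.
- by rewrite lerXn2r // ?nnegrE ?normr_ge0 ltW.
Qed.

Lemma le_eps_sqr (R : realType) (e r : R) : 0 < e -> r ^+ 2 <= e + r ^+ 4 / e.
Proof.
move=> e0; rewrite -(ler_pM2r e0) mulrDl divfK ?gt_eqF //.
have -> : r ^+ 4 = (r ^+ 2) ^+ 2 by rewrite -exprM.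
by have := sqr_ge0 (r ^+ 2 - e); have := sqr_ge0 r; nra.
Qed.

Section Walk.
Context d (T : measurableType d) (R : realType) (P : probability T R).
Variables (G : nat -> set (set T)) (v : R) (xi eta : nat -> T -> R).
Variables (M be x y : R).
Hypothesis M_gt1 : 1 < M.
Hypothesis G_meas : forall k, G k `<=` measurable.
Hypotheses (xi_noise : noise P G v xi) (eta_noise : noise P G v eta).

Local Notation X := (walk x xi).
Local Notation Y := (walk y eta).

Definition alive (k : nat) : set T :=
  [set w | forall j, (j <= k)%N -> 0 < quad M be (X j w) (Y j w)].

Local Notation A := alive.
Local Notation MX := (stopped_sum A xi x 0).
Local Notation MY := (stopped_sum A eta y 0).

Lemma walkS c (z : nat -> T -> R) k w : walk c z k.+1 w = walk c z k w + z k w.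
Proof. by rewrite /walk big_nat_recr //= addrA. Qed.

Lemma walk_adapted c z i k : noise P G v z -> (i <= k)%N -> adapted (G k) (walk c z i).
Proof.
move=> nz; elim: i => [_|i IHi ik].
  rewrite (_ : walk c z 0 = fun=> c); first exact: measurable_cst.
  by apply/funext => w; rewrite /walk big_geq // addr0.
rewrite (_ : walk c z i.+1 = fun w => walk c z i w + z i w); last first.
  by apply/funext => w; rewrite walkS.
by apply: measurable_funD; [apply: (IHi); exact: ltnW|exact: (noise_adapted nz)].
Qed.

Lemma aliveS k : A k.+1 = A k `&` [set w | 0 < quad M be (X k.+1 w) (Y k.+1 w)].
Proof.
apply/seteqP; split=> [w Aw|w [Aw Sw] j].
  by split=> [j jk|]; apply: Aw => //; exact: leqW.
by rewrite leq_eqVlt => /predU1P[->//|]; exact: Aw.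
Qed.

Lemma alive_adapted i k : (i <= k)%N -> <<s G k >> (A i).
Proof.
have mS j : (j <= k)%N ->
    <<s G k >> [set w | 0 < quad M be (X j w) (Y j w)].
  move=> jk; rewrite -[X in <<s _ >> X]/(
    (fun w => quad M be (X j w) (Y j w)) @^-1` [set r | 0 < r]).
  apply: adapted_preimage; last first.
    by rewrite -set_itvoy; exact: measurable_itv.
  apply: measurable_funD; last first.
    by apply: measurable_funX; exact: walk_adapted eta_noise jk.
  apply: measurable_funB => //; apply: measurable_funM => //.
  by apply: measurable_funX; exact: walk_adapted xi_noise jk.
elim: i => [_|i IHi ik].
  rewrite (_ : A 0 = [set w | 0 < quad M be (X 0 w) (Y 0 w)]); first exact: mS.
  by apply/seteqP; split=> w; [apply|move=> Sw j; rewrite leqn0 => /eqP ->].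
rewrite aliveS; apply: (@measurableI _ (g_sigma_algebraType (G k))); last exact: mS.
by apply: (IHi); exact: ltnW.
Qed.

Lemma alive_measurable k : measurable (A k).
Proof.
by apply: smallest_sub (alive_adapted (leqnn k)) => //; exact: sigma_algebra_measurable.
Qed.

Lemma alive_anti i j : (i <= j)%N -> A j `<=` A i.
Proof. by move=> ij w Aw k ki; apply: Aw; exact: leq_trans ij. Qed.

Lemma stopped_sum_alive c (z : nat -> T -> R) J K w : (J <= K)%N -> A K w ->
  stopped_sum A z c J K w = c + (walk 0 z K w - walk 0 z J w).
Proof.
move=> JK AK; rewrite /stopped_sum /walk !add0r (@big_cat_nat _ _ _ J 0 K) //=.
rewrite addrAC subrr add0r; congr (_ + _).
apply: eq_big_nat => i /andP[_ iK]; rewrite indicE mem_set ?mul1r //.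
exact: alive_anti (ltnW iK) _ AK.
Qed.

Lemma stopped_sum_walk c (z : nat -> T -> R) K w : A K w -> stopped_sum A z c 0 K w = walk c z K w.
Proof.
by move=> AK; rewrite stopped_sum_alive // /walk !add0r [X in _ - X]big_geq // subr0.
Qed.

Lemma stopped_sum_alive_step c (z : nat -> T -> R) K w : A K w ->
  stopped_sum A z c 0 K.+1 w = walk c z K.+1 w.
Proof.
move=> AK; rewrite stopped_sumS // stopped_sum_walk // walkS.
by rewrite indicE mem_set // mul1r.
Qed.

Lemma stopped_sum_dead_step c (z : nat -> T -> R) K w : ~ A K w ->
  stopped_sum A z c 0 K.+1 w = stopped_sum A z c 0 K w.
Proof. by move=> nAK; rewrite stopped_sumS // indicE memNset // mul0r addr0. Qed.

Let M_ge0 : 0 <= M. Proof. exact: le_trans ler01 (ltW M_gt1). Qed.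

(** If the walk has left the region by time [K], the frozen walk sits at its
exit point, where [quad] is not positive. *)
Lemma quad_stopped_le K w :
  quad M be (MX K w) (MY K w) <= \1_(A K) w * (`|M * be| + Y K w ^+ 2).
Proof.
have [AK|nAK] := pselect (A K w).
  rewrite !stopped_sum_walk // indicE mem_set // mul1r /quad lerD2r.
  apply: le_trans (ler_norm _); rewrite gerBl mulr_ge0 ?sqr_ge0 ?M_ge0 //.
rewrite indicE memNset // mul0r.
elim: K nAK => [|K IHK] nAK.
  rewrite leNgt; apply/negP => q0; apply: nAK => j; rewrite leqn0 => /eqP ->.
  by move: q0; rewrite /stopped_sum /walk !big_geq.
have [AK|nAK'] := pselect (A K w); last by rewrite !stopped_sum_dead_step // IHK.
rewrite !stopped_sum_alive_step // leNgt; apply/negP => q0; apply: nAK.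
by rewrite aliveS; split.
Qed.

(** Up to a multiple of [e], a bound for the amount by which [quad] can fall in
the step [k], by [le_eps_pow4] applied to the terms [2 X xi] and [2 Y eta] and
[le_eps_sqr] applied to [xi ^ 2]. *)
Definition overshoot (e : R) (k : nat) (w : T) : R :=
  (2 * M * (X k w * xi k w) ^+ 4 + 2 * (Y k w * eta k w) ^+ 4) / e ^+ 3 +
  M * (xi k w ^+ 4 / e).

Lemma overshoot_ge0 e k w : 0 < e -> 0 <= overshoot e k w.
Proof.
move=> e0; have M0 := M_ge0.
have e0' := ltW e0; apply: addr_ge0; last by rewrite mulr_ge0 // divr_ge0 ?pow4_ge0.
by rewrite divr_ge0 ?exprn_ge0 // addr_ge0 // mulr_ge0 ?pow4_ge0 // mulr_ge0.
Qed.

(** As long as the walk moves, [quad] is positive before each step, so it can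
become negative only in the exit step and a single term of the sum of overshoots
is at stake.  Bounding that term by the whole sum is affordable on average. *)
Lemma quad_stopped_ge e K w : 0 < e -> 0 <= quad M be x y ->
  - ((3 * M + 2) * e + \sum_(0 <= k < K) overshoot e k w) <=
  quad M be (MX K w) (MY K w).
Proof.
move=> e0 q0; have M0 := M_ge0.
elim: K => [|K IHK].
  rewrite /stopped_sum !big_geq // !addr0; apply: le_trans q0.
  by rewrite oppr_le0 mulr_ge0 // ?ltW //; lra.
have sum0 : 0 <= \sum_(0 <= k < K) overshoot e k w.
  by apply: sumr_ge0 => k _; exact: overshoot_ge0.
rewrite big_nat_recr //=.
have [AK|nAK] := pselect (A K w); last first.
  rewrite !stopped_sum_dead_step //; apply: le_trans IHK.
  by have := overshoot_ge0 K w e0; lra.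
rewrite !stopped_sum_alive_step // !walkS.
have := AK K (leqnn K); rewrite /quad.
set a := X K w; set b := Y K w; set s := xi K w; set t := eta K w.
have h1 := le_eps_pow4 (a * s) e0.
have h2 := le_eps_pow4 (b * t) e0.
have h3 := le_eps_sqr s e0.
have -> : overshoot e K w = 2 * M * ((a * s) ^+ 4 / e ^+ 3) +
    2 * ((b * t) ^+ 4 / e ^+ 3) + M * (s ^+ 4 / e) by rewrite /overshoot -/a -/b -/s -/t; ring.
set A1 := (a * s) ^+ 4 / e ^+ 3 in h1 *.
set B1 := (b * t) ^+ 4 / e ^+ 3 in h2 *.
set C1 := s ^+ 4 / e in h3 *.
have k1 : M * (a * s) <= M * (e + A1).
  by apply: ler_wpM2l => //; exact: le_trans (ler_norm _) h1.
have k2 : M * s ^+ 2 <= M * (e + C1) by apply: ler_wpM2l.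
have k3 : - (e + B1) <= b * t by rewrite lerNl (le_trans _ h2) // -normrN ler_norm.
have k4 := sqr_ge0 t.
have -> : (a + s) ^+ 2 = a ^+ 2 + 2 * (a * s) + s ^+ 2 by ring.
have -> : (b + t) ^+ 2 = b ^+ 2 + 2 * (b * t) + t ^+ 2 by ring.
lra.
Qed.

(** The mean of the exit time truncated at [K * v], for a walk with time step [v]:
the step [i] is made with probability [Ex P (\1_(A i))]. *)
Definition mean_time (K : nat) : R := v * \sum_(0 <= i < K) Ex P (\1_(A i)).

Let stopped_moment c z J K (nz : noise P G v z) (JK : (J <= K)%N) :
  L1 P (fun w => stopped_sum A z c J K w ^+ 2) /\
  Ex P (fun w => stopped_sum A z c J K w ^+ 2) =
    c ^+ 2 + (mean_time K - mean_time J).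
Proof.
have := stopped_sum_moment (A := A) G_meas (fun i k => @alive_adapted i k) nz c J (K - J).
rewrite subnKC // => -[l ->]; split=> //; congr (_ + _).
by rewrite /mean_time -mulrBr (@big_cat_nat _ _ _ J 0 K) //= addrAC subrr add0r.
Qed.

(** The optional stopping identity.  It is exact since [quad] has degree two and
the second moments of both frozen coordinates grow like the mean time. *)
Lemma quad_stopped_mean K :
  L1 P (fun w => quad M be (MX K w) (MY K w)) /\
  Ex P (fun w => quad M be (MX K w) (MY K w)) =
    quad M be x y - (M - 1) * mean_time K.
Proof.
have [lX EX] := stopped_moment x xi_noise (leq0n K).
have [lY EY] := stopped_moment y eta_noise (leq0n K).
have lX' := L1Z (- M) lX; have lY' := L1D lX' lY.
rewrite (_ : (fun w => _) = (fun w => M * be +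
    (- M * MX K w ^+ 2 + MY K w ^+ 2))); last first.
  by apply/funext => w; rewrite /quad mulNr addrA.
split; first by apply: L1D => //; exact: L1_cst.
rewrite ExD ?Ex_cst ?ExD ?ExZ ?EX ?EY //; last exact: L1_cst.
by rewrite /quad [mean_time 0]/mean_time big_geq //; ring.
Qed.

Lemma overshoot_mean e C k : 0 < e -> 0 <= C ->
  L1 P (fun w => X k w ^+ 4) -> Ex P (fun w => X k w ^+ 4) <= C ->
  L1 P (fun w => Y k w ^+ 4) -> Ex P (fun w => Y k w ^+ 4) <= C ->
  L1 P (overshoot e k) /\
  Ex P (overshoot e k) <=
    (2 * M + 2) * C * (64 * v ^+ 2) / e ^+ 3 + M * (64 * v ^+ 2) / e.
Proof.
move=> e0 C0 lX EX lY EY; have M0 := M_ge0.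
have pow4 (c : R) z (Z := walk c z) : noise P G v z ->
    L1 P (fun w => Z k w ^+ 4) -> Ex P (fun w => Z k w ^+ 4) <= C ->
    L1 P (fun w => (Z k w * z k w) ^+ 4) /\
    Ex P (fun w => (Z k w * z k w) ^+ 4) <= C * (64 * v ^+ 2).
  move=> nz lZ EZ; have mz := noise_meas nz k.
  have aZ : adapted (G k) (fun w => Z k w ^+ 4).
    by apply: measurable_funX; exact: walk_adapted.
  have [l E] := Ex_indep (@G_meas k) aZ (measurable_funX 4 mz)
    (independent_from_comp (measurable_funX 4 (@measurable_id _ _ _))
      (noise_indep nz (k := k))) lZ (noise_L4 nz k).
  rewrite (_ : (fun w => _) = (fun w => Z k w ^+ 4 * z k w ^+ 4)); last first.
    by apply/funext => w; rewrite exprMn.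
  split=> //; rewrite E; apply: ler_pM => //; last exact: (noise_moment4 nz).
    by apply: Ex_ge0 => w; rewrite pow4_ge0.
  by apply: Ex_ge0 => w; rewrite pow4_ge0.
have [l1 E1] := pow4 x xi xi_noise lX EX.
have [l2 E2] := pow4 y eta eta_noise lY EY.
have l3 := noise_L4 xi_noise k; have E3 := noise_moment4 xi_noise k.
have l1' := L1Z (2 * M / e ^+ 3) l1; have l2' := L1Z (2 / e ^+ 3) l2.
have l3' := L1Z (M / e) l3; have l12 := L1D l1' l2'.
rewrite (_ : overshoot e k = (fun w => (2 * M / e ^+ 3 * (X k w * xi k w) ^+ 4
  + 2 / e ^+ 3 * (Y k w * eta k w) ^+ 4) + M / e * xi k w ^+ 4)); last first.
  by apply/funext => w; rewrite /overshoot; ring.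
split; first exact: L1D.
have e3 : 0 < e ^+ 3 by rewrite exprn_gt0.
rewrite ExD // ExD // !ExZ // lerD //.
- rewrite [leRHS](_ : _ = 2 * M / e ^+ 3 * (C * (64 * v ^+ 2))
    + 2 / e ^+ 3 * (C * (64 * v ^+ 2))); last by ring.
  apply: lerD; apply: ler_wpM2l => //; first by apply: divr_ge0; [exact: mulr_ge0|exact: ltW].
  by apply: divr_ge0 => //; exact: ltW.
- rewrite [leRHS](_ : _ = M / e * (64 * v ^+ 2)); last by ring.
  by apply: ler_wpM2l => //; apply: divr_ge0 => //; exact: ltW.
Qed.

(** As [K * v] is the time horizon, the last term is of order [v] once [e] is
fixed. *)
Lemma mean_time_le e C K : 0 < e -> 0 <= C -> 0 <= quad M be x y ->
  (forall k, (k < K)%N -> L1 P (fun w => X k w ^+ 4) /\ Ex P (fun w => X k w ^+ 4) <= C) ->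
  (forall k, (k < K)%N -> L1 P (fun w => Y k w ^+ 4) /\ Ex P (fun w => Y k w ^+ 4) <= C) ->
  (M - 1) * mean_time K <= quad M be x y + (3 * M + 2) * e +
   K%:R * ((2 * M + 2) * C * (64 * v ^+ 2) / e ^+ 3 + M * (64 * v ^+ 2) / e).
Proof.
move=> e0 C0 q0 hX hY; set B := _ / e ^+ 3 + _.
have [lq Eq] := quad_stopped_mean K.
pose O (i : 'I_K) := overshoot e i.
have hO (i : 'I_K) : L1 P (O i) /\ Ex P (O i) <= B.
  have [lX EX] := hX i (ltn_ord i); have [lY EY] := hY i (ltn_ord i).
  exact: overshoot_mean.
have lO : L1 P (fun w => \sum_(i < K) O i w) by apply: L1_sum => i; case: (hO i).
have lO' := L1D (L1_cst P ((3 * M + 2) * e)) lO.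
have : Ex P (fun w => - ((3 * M + 2) * e + \sum_(i < K) O i w)) <=
    quad M be x y - (M - 1) * mean_time K.
  rewrite -Eq; apply: (Ex_le (L1N lO') lq) => w.
  by have := quad_stopped_ge K w e0 q0; rewrite big_mkord.
rewrite (_ : (fun w => - _) = (fun w => -1 * ((3 * M + 2) * e + \sum_(i < K) O i w))); last first.
  by apply/funext => w; rewrite mulN1r.
rewrite ExZ // ExD ?Ex_cst //; last exact: L1_cst.
rewrite Ex_sum; last by move=> i; case: (hO i).
have : \sum_(i < K) Ex P (O i) <= K%:R * B.
  apply: (@le_trans _ _ (\sum_(i < K) B)); last by rewrite sumr_const card_ord mulr_natl.
  by apply: ler_sum => i _; case: (hO i).
lra.
Qed.

(** Over the paths still inside at time [K], the second coordinate at [K] is the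
one at [J] plus the displacement in between.  The variance of the latter is the
mean time spent inside between [J] and [K]; the square of the former is cut at
level [L], the excess being controlled by a fourth moment. *)
Lemma mean_time_ge L C J K : 0 < L -> (J <= K)%N ->
  L1 P (fun w => Y J w ^+ 4) -> Ex P (fun w => Y J w ^+ 4) <= C ->
  quad M be x y - ((`|M * be| + 2 * L) * Ex P (\1_(A K)) + 2 * C / L +
    2 * (mean_time K - mean_time J)) <= (M - 1) * mean_time K.
Proof.
move=> L0 JK lY EY; have [lq Eq] := quad_stopped_mean K.
set D := stopped_sum A eta 0 J K.
have [lD ED] : L1 P (fun w => D w ^+ 2) /\ Ex P (fun w => D w ^+ 2) =
    0 ^+ 2 + (mean_time K - mean_time J) by exact: stopped_moment.
have lA := L1_indic P (alive_measurable K).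
set c := `|M * be| + 2 * L.
have c0 : 0 <= c by rewrite addr_ge0 // mulr_ge0 // ltW.
have l1 := L1Z c lA; have l2 := L1Z (2 / L) lY; have l3 := L1Z 2 lD.
have l12 := L1D l1 l2.
have : quad M be x y - (M - 1) * mean_time K <= c * Ex P (\1_(A K)) +
    2 / L * Ex P (fun w => Y J w ^+ 4) + 2 * (0 ^+ 2 + (mean_time K - mean_time J)).
  rewrite -Eq -ED -!ExZ // -ExD // -ExD //; apply: (Ex_le lq (L1D l12 l3)) => w.
  apply: le_trans (quad_stopped_le K w) _.
  have h1 := le_eps_sqr (Y J w) L0.
  have h0 : 0 <= Y J w ^+ 4 / L by rewrite divr_ge0 ?(ltW L0) // pow4_ge0.
  have -> : 2 / L * Y J w ^+ 4 = 2 * (Y J w ^+ 4 / L) by ring.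
  have [AK|nAK] := pselect (A K w); last first.
    rewrite indicE memNset // mul0r mulr0 add0r.
    by apply: addr_ge0; apply: mulr_ge0 => //; exact: sqr_ge0.
  rewrite indicE mem_set // mul1r mulr1 /c.
  have -> : Y K w = Y J w + D w.
    by rewrite /D stopped_sum_alive // /walk; ring.
  set Z := _ / L in h0 h1 *; have := sqr_ge0 (Y J w - D w).
  have -> : (Y J w + D w) ^+ 2 = 2 * Y J w ^+ 2 + 2 * D w ^+ 2 - (Y J w - D w) ^+ 2 by ring.
  lra.
have : 2 / L * Ex P (fun w => Y J w ^+ 4) <= 2 / L * C.
  by apply: ler_wpM2l => //; rewrite divr_ge0 // ltW.
rewrite expr0n /= add0r [2 * C / L]mulrAC; lra.
Qed.

End Walk.

(** * Brownian increments along a grid *)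
Section BrownianIncrements.
Context d (T : measurableType d) (R : realType) (P : probability T R).
Implicit Types (B : R -> T -> R) (C : nat -> set R) (del : R) (k : nat).

Definition increment B del k (w : T) : R :=
  B (k.+1%:R * del) w - B (k%:R * del) w.

Definition cylinder B del k C : set T :=
  [set w | forall i, (i < k)%N -> C i (increment B del i w)].

Definition cylinders B del k : set (set T) :=
  [set cylinder B del k C | C in [set C | forall i, measurable (C i)]].

(** A pi-system generating the sigma-algebra of the first [k] increments of both
coordinates, made of sets whose probabilities the product rules determine. *)
Definition past B1 B2 del k : set (set T) :=
  [set E1 `&` E2 | E1 in cylinders B1 del k & E2 in cylinders B2 del k].

Lemma pastC B1 B2 del k : past B1 B2 del k = past B2 B1 del k.
Proof.
by apply/seteqP; split=> E [E1 cE1 [E2 cE2 <-]]; exists E2 => //; exists E1 => //;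
  rewrite setIC.
Qed.

Lemma independent_processesC B1 B2 :
  independent_processes P B1 B2 -> independent_processes P B2 B1.
Proof. by move=> ind E F sE sF; rewrite setIC ind // muleC. Qed.

Lemma cylinderI B del k C1 C2 : cylinder B del k C1 `&` cylinder B del k C2 =
  cylinder B del k (fun i => C1 i `&` C2 i).
Proof.
apply/seteqP; split=> [w [h1 h2] i ik|w h]; first by split; [exact: h1|exact: h2].
by split=> i ik; case: (h i ik).
Qed.

Lemma cylinderS B del k C : cylinder B del k.+1 C =
  cylinder B del k C `&` increment B del k @^-1` C k.
Proof.
apply/seteqP; split=> [w h|w [h hk] i].
  by split; [move=> i ik; apply: h; exact: leqW|exact: h].
by rewrite ltnS leq_eqVlt => /predU1P[->//|]; exact: h.
Qed.

Lemma cylinder0 B del C : cylinder B del 0 C = [set: T].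
Proof. by apply/seteqP; split. Qed.

Lemma cylinder_setT B del k : cylinder B del k (fun=> [set: R]) = [set: T].
Proof. by apply/seteqP; split. Qed.

Lemma cylinder_in B del k C : (forall i, measurable (C i)) ->
  cylinders B del k (cylinder B del k C).
Proof. by move=> mC; exists C. Qed.

Lemma pastI B1 B2 del k : setI_closed (past B1 B2 del k).
Proof.
move=> _ _ [_ [C1 m1 <-] [_ [C2 m2 <-] <-]] [_ [C3 m3 <-] [_ [C4 m4 <-] <-]].
rewrite setIACA !cylinderI.
exists (cylinder B1 del k (fun i => C1 i `&` C3 i)).
  by apply: cylinder_in => i; exact: measurableI.
exists (cylinder B2 del k (fun i => C2 i `&` C4 i)) => //.
by apply: cylinder_in => i; exact: measurableI.
Qed.

Lemma pastT B1 B2 del k : past B1 B2 del k [set: T].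
Proof.
exists [set: T]; first by rewrite -(cylinder_setT B1 del k); exact: cylinder_in.
exists [set: T]; first by rewrite -(cylinder_setT B2 del k); exact: cylinder_in.
by rewrite setIT.
Qed.

Lemma adapted_increment B1 B2 del i k : (i < k)%N ->
  adapted (past B1 B2 del k) (increment B1 del i).
Proof.
move=> ik _ C mC; rewrite setTI; apply: sub_sigma_algebra.
exists (cylinder B1 del k (fun j => if j == i then C else [set: R])).
  by apply: cylinder_in => j; case: ifP.
exists [set: T]; first by rewrite -(cylinder_setT B2 del k); exact: cylinder_in.
rewrite setIT; apply/seteqP; split=> [w /(_ i ik)|w Cw j jk].
  by rewrite eqxx.
by case: eqP => // ->.
Qed.

Lemma process_sigma_algebra_increment B del k (C : set R) : 0 <= del -> measurable C ->
  process_sigma_algebra B (increment B del k @^-1` C).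
Proof.
move=> del0 mC.
set F := \bigcup_(t in [set t : R | 0 <= t]) g_sigma_algebra_preimage (B t).
have aB t : 0 <= t -> adapted F (B t).
  move=> t0 _ D mD; rewrite setTI; apply: sub_sigma_algebra.
  by exists t => //; exists D => //; rewrite setTI.
apply: (@adapted_preimage _ _ _ F _ _ _ mC).
by apply: measurable_funB; apply: aB; rewrite mulr_ge0.
Qed.

Lemma process_sigma_algebra_cylinder B del k C : 0 <= del ->
  (forall i, measurable (C i)) -> process_sigma_algebra B (cylinder B del k C).
Proof.
move=> del0 mC; elim: k => [|k IHk].
  by rewrite cylinder0; exact: (@measurableT _ (g_sigma_algebraType _)).
rewrite cylinderS; apply: (@measurableI _ (g_sigma_algebraType _)) => //.
exact: process_sigma_algebra_increment.
Qed.

Section OneBrownianMotion.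
Variables (x : R) (B : R -> T -> R) (del : R).
Hypotheses (bm : brownian_motion P x B) (del_gt0 : 0 < del).

Lemma increment_measurable k : measurable_fun [set: T] (increment B del k).
Proof.
by apply: measurable_funB; apply: (bm_measurable bm); rewrite mulr_ge0 // ltW.
Qed.

Lemma cylinder_measurable k C : (forall i, measurable (C i)) ->
  measurable (cylinder B del k C).
Proof.
move=> mC; elim: k => [|k IHk]; first by rewrite cylinder0.
rewrite cylinderS; apply: measurableI => //.
by rewrite -[_ @^-1` _]setTI; exact: increment_measurable.
Qed.

Lemma cylinder_prob k C : (forall i, measurable (C i)) ->
  P (cylinder B del k C) = (\prod_(i < k) P (increment B del i @^-1` C i))%E.
Proof.
move=> mC; rewrite -(bm_indep_increments bm (t := fun i => i%:R * del)
  _ _ (fun i : 'I_k => mC i)).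
- congr (P _); apply/seteqP; split=> [w h i _|w h i ik]; first exact: h.
  exact: (h (Ordinal ik) I).
- by rewrite mul0r.
- by move=> i j ij; rewrite ler_pM2r // ler_nat.
Qed.

(** The product rules for [k + 1] and for [k] increments differ by one factor. *)
Lemma increment_indep_cylinder k C : (forall i, measurable (C i)) ->
  P (cylinder B del k C `&` increment B del k @^-1` C k) =
  (P (cylinder B del k C) * P (increment B del k @^-1` C k))%E.
Proof. by move=> mC; rewrite -cylinderS !cylinder_prob // big_ord_recr. Qed.

Lemma increment_gaussian (s t : R) : 0 <= s -> s < t ->
  let X w := B t w - B s w in
  [/\ L1 P (fun w => X w ^+ 4), Ex P X = 0, Ex P (fun w => X w ^+ 2) = t - s
    & Ex P (fun w => X w ^+ 4) <= 64 * (t - s) ^+ 2].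
Proof.
move=> s0 st X; have ts : 0 < t - s by rewrite subr_gt0.
have sq0 : 0 < Num.sqrt (t - s) by rewrite sqrtr_gt0.
have mX : measurable_fun [set: T] X.
  by apply: measurable_funB; apply: (bm_measurable bm) => //; exact: le_trans (ltW st).
have law := bm_gaussian_increments bm s0 st.
have [l4 E4] := gaussian_moment4 mX sq0 law.
have sqE : Num.sqrt (t - s) ^+ 2 = t - s by rewrite sqr_sqrtr // ltW.
split=> //.
- exact: gaussian_mean mX sq0 law.
- by rewrite (gaussian_variance mX sq0 law).
- by move: E4; rewrite (exprM _ 2 2) sqE.
Qed.

End OneBrownianMotion.

Section TwoBrownianMotions.
Variables (x y : R) (B1 B2 : R -> T -> R) (del : R).
Hypotheses (bm1 : brownian_motion P x B1) (bm2 : brownian_motion P y B2).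
Hypothesis ind : independent_processes P B1 B2.
Hypothesis del_gt0 : 0 < del.

Lemma past_measurable k : past B1 B2 del k `<=` measurable.
Proof.
move=> _ [_ [C1 m1 <-] [_ [C2 m2 <-] <-]].
by apply: measurableI; [exact: (cylinder_measurable bm1)|exact: (cylinder_measurable bm2)].
Qed.

(** An increment of the first coordinate is independent of the past of this
coordinate by independence of increments, and of both pasts because the two
coordinates are independent processes. *)
Lemma increment_noise : noise P (past B1 B2 del) del (increment B1 del).
Proof.
have gs k := @increment_gaussian x B1 bm1 (k%:R * del) (k.+1%:R * del).
have delE k : k.+1%:R * del - k%:R * del = del by rewrite -natr1; ring.
have {}gs k : [/\ L1 P (fun w => increment B1 del k w ^+ 4),
    Ex P (increment B1 del k) = 0, Ex P (fun w => increment B1 del k w ^+ 2) = del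
    & Ex P (fun w => increment B1 del k w ^+ 4) <= 64 * del ^+ 2].
  have := gs k; rewrite delE; apply; first by rewrite mulr_ge0 // ltW.
  by rewrite ltr_pM2r // ltr_nat.
split.
- by move=> i k ik; exact: adapted_increment.
- move=> k; apply: independent_from_pi.
  + exact: (increment_measurable bm1).
  + exact: past_measurable.
  + exact: pastI.
  + exact: pastT.
  + move=> _ C [_ [C1 m1 <-] [_ [C2 m2 <-] <-]] mC.
    pose C1' i := if i == k then C else C1 i.
    have mC1' i : measurable (C1' i) by rewrite /C1'; case: ifP.
    have C1E : cylinder B1 del k C1 = cylinder B1 del k C1'.
      by apply/seteqP; split=> w h i ik; have := h i ik; rewrite /C1' ltn_eqF.
    have := increment_indep_cylinder bm1 del_gt0 k mC1'.
    rewrite -C1E /C1' eqxx => E1.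
    have d0 := ltW del_gt0.
    have s1 : process_sigma_algebra B1 (cylinder B1 del k C1).
      exact: process_sigma_algebra_cylinder.
    have s2 : process_sigma_algebra B2 (cylinder B2 del k C2).
      exact: process_sigma_algebra_cylinder.
    have s3 : process_sigma_algebra B1 (increment B1 del k @^-1` C).
      exact: process_sigma_algebra_increment.
    rewrite setIAC ind //; last exact: (@measurableI _ (g_sigma_algebraType _)).
    by rewrite E1 ind // muleAC.
- by move=> k; exact: (increment_measurable bm1).
- by move=> k; case: (gs k).
- by move=> k; case: (gs k).
- by move=> k; case: (gs k).
- by move=> k; case: (gs k).
Qed.

End TwoBrownianMotions.
End BrownianIncrements.

(** * Refining dyadic grids *)
Section DyadicExit.
Context d (T : measurableType d) (R : realType) (P : probability T R).
Variables (x y x0 y0 : R) (B1 B2 : R -> T -> R) (M be : R).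
Hypotheses (bm1 : brownian_motion P x0 B1) (bm2 : brownian_motion P y0 B2).
Hypothesis ind : independent_processes P B1 B2.
Hypothesis M_gt1 : 1 < M.

(** A Brownian motion starts at its initial value only almost surely; this
modification does so surely and has the same increments. *)
Definition recentered (c : R) (B : R -> T -> R) (r : R) (w : T) : R :=
  c + (B r w - B 0 w).

Lemma walk_increment c B del k w :
  walk c (increment B del) k w = recentered c B (k%:R * del) w.
Proof.
elim: k => [|k IHk]; first by rewrite /walk big_geq // /recentered mul0r subrr.
by rewrite walkS IHk /recentered /increment; ring.
Qed.

Lemma recentered_moment4 x' c B r t : brownian_motion P x' B -> 0 <= r <= t ->
  L1 P (fun w => recentered c B r w ^+ 4) /\
  Ex P (fun w => recentered c B r w ^+ 4) <= 8 * c ^+ 4 + 512 * t ^+ 2.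
Proof.
move=> bm /andP[r0 rt].
have t0 : 0 <= t := le_trans r0 rt.
have [l E] : L1 P (fun w => (B r w - B 0 w) ^+ 4) /\
    Ex P (fun w => (B r w - B 0 w) ^+ 4) <= 64 * t ^+ 2.
  move: r0; rewrite le_eqVlt => /predU1P[<-|r0].
    rewrite (_ : (fun w => _) = fun=> 0); last first.
      by apply/funext => w; rewrite subrr expr0n.
    by rewrite Ex_cst; split; [exact: L1_cst|rewrite mulr_ge0 // sqr_ge0].
  have [l _ _ E] := increment_gaussian bm (lexx 0) r0.
  split=> //; apply: le_trans E _; rewrite subr0 ler_wpM2l //.
  by rewrite lerXn2r // ?nnegrE // ltW.
have l' := L1D (L1_cst P (8 * c ^+ 4)) (L1Z 8 l).
have le w : recentered c B r w ^+ 4 <= 8 * c ^+ 4 + 8 * (B r w - B 0 w) ^+ 4.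
  rewrite /recentered; set u := B r w - _.
  rewrite [(c + u) ^+ 4](exprM _ 2 2).
  have -> : c ^+ 4 = (c ^+ 2) ^+ 2 by rewrite -exprM.
  have -> : u ^+ 4 = (u ^+ 2) ^+ 2 by rewrite -exprM.
  have h4 : (c + u) ^+ 2 <= 2 * (c ^+ 2 + u ^+ 2).
    by rewrite -subr_ge0 (_ : _ - _ = (c - u) ^+ 2) ?sqr_ge0 //; ring.
  apply: (@le_trans _ _ ((2 * (c ^+ 2 + u ^+ 2)) ^+ 2)).
    by rewrite lerXn2r // nnegrE ?sqr_ge0 // mulr_ge0 // addr_ge0 ?sqr_ge0.
  by rewrite -subr_ge0 (_ : _ - _ = 4 * (c ^+ 2 - u ^+ 2) ^+ 2); [rewrite mulr_ge0 ?sqr_ge0|ring].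
have mrc : measurable_fun [set: T] (recentered c B r).
  by apply: measurable_funD => //; apply: measurable_funB; exact: (bm_measurable bm).
have lX : L1 P (fun w => recentered c B r w ^+ 4).
  apply: L1_le l'; first exact: measurable_funX.
  by move=> w; rewrite ger0_norm // pow4_ge0.
split=> //; apply: le_trans (Ex_le lX l' le) _.
rewrite ExD ?Ex_cst ?ExZ //; [lra|exact: L1_cst|exact: L1Z].
Qed.

Definition del (n : nat) : R := (2 ^- n).

Lemma del_gt0 n : 0 < del n. Proof. by rewrite invr_gt0 exprn_gt0. Qed.

Lemma delS n : 2 * del n.+1 = del n.
Proof. by rewrite /del exprS invfM mulrA mulfV // mul1r. Qed.

Definition grid (t n : nat) : nat := (t * 2 ^ n)%N.

Lemma grid_del t n : (grid t n)%:R * del n = t%:R.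
Proof. by rewrite /grid /del natrM natrX mulfK // expf_neq0. Qed.

Definition survives (n k : nat) : set T :=
  alive (increment B1 (del n)) (increment B2 (del n)) M be x y k.

Lemma survivesE n k : survives n k = [set w | forall j, (j <= k)%N ->
  0 < quad M be (recentered x B1 (j%:R * del n) w)
                (recentered y B2 (j%:R * del n) w)].
Proof.
by apply/seteqP; split=> w h j jk; have := h j jk; rewrite !walk_increment.
Qed.

(** The exit time along the grid of mesh [del n], truncated at [t]. *)
Definition grid_time (n t : nat) (w : T) : R :=
  \sum_(0 <= k < grid t n) del n * \1_(survives n k) w.

Let past_m n k : past B1 B2 (del n) k `<=` measurable.
Proof. exact: (past_measurable bm1 bm2 (del_gt0 n)). Qed.

Let noise1 n : noise P (past B1 B2 (del n)) (del n) (increment B1 (del n)).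
Proof. exact: (increment_noise bm1 bm2 ind (del_gt0 n)). Qed.

Let noise2 n : noise P (past B1 B2 (del n)) (del n) (increment B2 (del n)).
Proof.
rewrite (_ : past B1 B2 (del n) = past B2 B1 (del n)).
  exact: (increment_noise bm2 bm1 (independent_processesC ind) (del_gt0 n)).
by apply/funext => k; exact: pastC.
Qed.

Lemma survives_measurable n k : measurable (survives n k).
Proof. exact: (alive_measurable _ _ _ _ (@past_m n) (noise1 n) (noise2 n)). Qed.

Lemma grid_time_L1 n t : L1 P (grid_time n t).
Proof.
by apply: L1_sum => k; apply: L1Z; apply: L1_indic; exact: survives_measurable.
Qed.

Definition mean_exit n t : R := Ex P (grid_time n t).

Lemma mean_exitE n t : mean_exit n t =
  mean_time P (del n) (increment B1 (del n)) (increment B2 (del n)) M be x y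
    (grid t n).
Proof.
have lk k : L1 P (\1_(survives n k)) by apply: L1_indic; exact: survives_measurable.
rewrite /mean_exit /grid_time Ex_sum; last by move=> k; exact: L1Z.
by rewrite /mean_time mulr_sumr; apply: eq_bigr => k _; rewrite ExZ.
Qed.

Lemma grid_time_ge0 n t w : 0 <= grid_time n t w.
Proof.
apply: sumr_ge0 => k _; apply: mulr_ge0; first exact/ltW/del_gt0.
by case: (indic_01 R (survives n k) w) => ->.
Qed.

Lemma grid_time_le n t w : grid_time n t w <= t%:R.
Proof.
rewrite -(grid_del t n) /grid_time big_mkord.
apply: (@le_trans _ _ (\sum_(k < grid t n) del n)).
  by apply: ler_sum => k _; rewrite ler_piMr // ltW // del_gt0.
by rewrite sumr_const card_ord mulr_natl.
Qed.

Lemma survives_refine n k : survives n.+1 k.*2 `<=` survives n k.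
Proof.
rewrite !survivesE => w h j jk; have := h j.*2; rewrite leq_double => /(_ jk).
by rewrite -(delS n) -muln2 natrM mulrA.
Qed.

(** A finer grid detects at least the exits that a coarser one does: each interval
of the coarse grid is compared with its two halves. *)
Lemma grid_time_decr n t w : grid_time n.+1 t w <= grid_time n t w.
Proof.
rewrite /grid_time (_ : grid t n.+1 = (grid t n).*2); last first.
  by rewrite /grid expnS -muln2 mulnCA mulnC.
elim: (grid t n) => [|K IHK]; first by rewrite !big_geq.
rewrite doubleS !big_nat_recr //= -addrA lerD //.
rewrite -(delS n) -mulrA mulr_natl [leRHS]mulr2n.
have le k : (K.*2 <= k)%N ->
    del n.+1 * (\1_(survives n.+1 k) w : R) <= del n.+1 * \1_(survives n K) w.
  move=> Kk; apply: ler_wpM2l; first exact/ltW/del_gt0.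
  have [/set_mem sk|nk] := boolP (w \in survives n.+1 k); last first.
    by rewrite indicE (negbTE nk); case: (indic_01 R (survives n K) w) => ->.
  rewrite !indicE !mem_set //; apply: survives_refine => j jK.
  by apply: sk; exact: leq_trans Kk.
by apply: lerD; apply: le.
Qed.

Definition moment_bound (t : nat) : R := 8 * (x ^+ 4 + y ^+ 4) + 512 * t%:R ^+ 2.

Lemma moment_bound_ge0 t : 0 <= moment_bound t.
Proof.
by rewrite addr_ge0 // mulr_ge0 ?sqr_ge0 // addr_ge0 // pow4_ge0.
Qed.

Let walk_moment c x' B n t k : brownian_motion P x' B ->
  (c ^+ 4 <= x ^+ 4 + y ^+ 4) -> (k <= grid t n)%N ->
  L1 P (fun w => walk c (increment B (del n)) k w ^+ 4) /\
  Ex P (fun w => walk c (increment B (del n)) k w ^+ 4) <= moment_bound t.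
Proof.
move=> bm cxy kt.
rewrite (_ : (fun w => _) = (fun w => recentered c B (k%:R * del n) w ^+ 4)); last first.
  by apply/funext => w; rewrite walk_increment.
have [|l E] := @recentered_moment4 x' c B (k%:R * del n) t%:R bm.
  rewrite mulr_ge0 ?(ltW (del_gt0 n)) //= -(grid_del t n) ler_pM2r ?del_gt0 //.
  by rewrite ler_nat.
by split=> //; apply: le_trans E _; rewrite lerD2r ler_pM2l.
Qed.

Lemma mean_exit_le n t e : 0 < e -> 0 <= quad M be x y ->
  (M - 1) * mean_exit n t <= quad M be x y + (3 * M + 2) * e +
   del n * (t%:R * (64 * ((2 * M + 2) * moment_bound t / e ^+ 3 + M / e))).
Proof.
move=> e0 q0; rewrite mean_exitE.
have := @mean_time_le _ _ _ _ _ _ _ _ _ _ _ _ M_gt1 (@past_m n) (noise1 n) (noise2 n)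
  e (moment_bound t) (grid t n) e0 (moment_bound_ge0 t) q0.
move=> /(_ _ _)/le_trans; apply.
- by move=> k kK; apply: (walk_moment bm1); [rewrite lerDl pow4_ge0|exact: ltnW].
- by move=> k kK; apply: (walk_moment bm2); [rewrite lerDr pow4_ge0|exact: ltnW].
- rewrite lerD2l -[X in _ <= _ * (X * _)](grid_del t n).
  by rewrite le_eqVlt; apply/orP; left; apply/eqP; ring.
Qed.

Lemma mean_exit_ge n s t L : 0 < L -> (s <= t)%N -> (0 < t)%N ->
  quad M be x y - ((`|M * be| + 2 * L) * (mean_exit n t / t%:R)
    + 2 * moment_bound s / L + 2 * (mean_exit n t - mean_exit n s)) <=
  (M - 1) * mean_exit n t.
Proof.
move=> L0 st t0.
have sK : (grid s n <= grid t n)%N by rewrite /grid leq_mul2r st orbT.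
have [lY EY] : L1 P (fun w => walk y (increment B2 (del n)) (grid s n) w ^+ 4) /\
    Ex P (fun w => walk y (increment B2 (del n)) (grid s n) w ^+ 4) <= moment_bound s.
  by apply: (walk_moment bm2) => //; rewrite lerDr pow4_ge0.
have := mean_time_ge be x M_gt1 (@past_m n) (noise1 n) (noise2 n) L0 sK lY EY.
rewrite -!mean_exitE -/(survives n (grid t n)); apply: le_trans.
have lk k : L1 P (\1_(survives n k)) by apply: L1_indic; exact: survives_measurable.
rewrite lerD2l lerN2 !lerD2r ler_wpM2l ?addr_ge0 ?mulr_ge0 ?(ltW L0) //.
rewrite ler_pdivlMr ?ltr0n // mean_exitE /mean_time -(grid_del t n) mulrA mulrC.
rewrite ler_wpM2l ?(ltW (del_gt0 n)) // big_mkord.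
apply: (@le_trans _ _ (\sum_(k < grid t n) Ex P (\1_(survives n (grid t n))))).
  by rewrite sumr_const card_ord mulr_natr.
apply: ler_sum => k _; apply: (Ex_le (lk _) (lk _)) => w.
have [/set_mem sk|nk] := boolP (w \in survives n (grid t n)); last first.
  by rewrite indicE (negbTE nk); case: (indic_01 R (survives n k) w) => ->.
rewrite !indicE !mem_set //.
exact: alive_anti (ltnW (ltn_ord k)) _ sk.
Qed.

Definition exit_limit t w : R := limn (fun n => grid_time n t w).

Lemma grid_time_cvg t w : grid_time n t w @[n --> \oo] --> exit_limit t w.
Proof.
apply: nonincreasing_is_cvgn.
  by apply/nonincreasing_seqP => n; exact: grid_time_decr.
by exists 0 => _ [n _ <-]; exact: grid_time_ge0.
Qed.

Lemma exit_limit_le n t w : exit_limit t w <= grid_time n t w.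
Proof.
apply: (nonincreasing_cvgn_ge (u_ := fun n => grid_time n t w)); last exact: grid_time_cvg.
by apply/nonincreasing_seqP => k; exact: grid_time_decr.
Qed.

Lemma exit_limit_ge0 t w : 0 <= exit_limit t w.
Proof.
by apply: limr_ge; [exact: grid_time_cvg|apply: nearW => n; exact: grid_time_ge0].
Qed.

Lemma exit_limit_L1 t : L1 P (exit_limit t).
Proof.
apply: (@L1_le _ _ _ _ _ (fun=> t%:R)); last exact: L1_cst.
  apply: (@measurable_fun_cvg _ _ _ _ (fun n => grid_time n t)).
    by move=> n; exact: L1_measurable (grid_time_L1 n t).
  by move=> w _; exact: grid_time_cvg.
move=> w; rewrite ger0_norm ?exit_limit_ge0 //.
exact: le_trans (exit_limit_le 0 t w) (grid_time_le 0 t w).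
Qed.

Definition mean_limit t := Ex P (exit_limit t).

Lemma mean_exit_cvg t : mean_exit n t @[n --> \oo] --> mean_limit t.
Proof.
have [] := @dominated_convergence _ T R P [set: T] measurableT
  (fun n w => (grid_time n t w)%:E) (fun w => (exit_limit t w)%:E) (fun=> (t%:R)%:E).
- by move=> n; apply/measurable_EFinP; exact: L1_measurable (grid_time_L1 n t).
- by apply/measurable_EFinP; exact: L1_measurable (exit_limit_L1 t).
- by apply: aeW => w _; apply: cvg_EFin; [exact: nearW|exact: grid_time_cvg].
- exact: L1_cst.
- by apply: aeW => w n _; rewrite lee_fin ger0_norm ?grid_time_ge0 // grid_time_le.
move=> _ _; rewrite (ExE (exit_limit_L1 t)).
under eq_fun do rewrite (ExE (grid_time_L1 _ t)).
by move/fine_cvgP => [].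
Qed.

Lemma del_cvg0 : del n @[n --> \oo] --> 0.
Proof.
rewrite (_ : del = fun n => 2^-1 ^+ n); last by apply/funext => n; rewrite exprVn.
by apply: cvg_expr; rewrite ger0_norm ?invr_ge0 // invf_lt1 // ltr1n.
Qed.

Lemma mean_limit_le t : 0 <= quad M be x y ->
  (M - 1) * mean_limit t <= quad M be x y.
Proof.
move=> q0; apply/ler_addgt0Pr => e' e'0.
have M30 : 0 < 3 * M + 2 by have := M_gt1; lra.
set e := e' / (3 * M + 2); have e0 : 0 < e by rewrite divr_gt0.
have -> : e' = (3 * M + 2) * e by rewrite /e mulrC divfK ?gt_eqF.
set Q := t%:R * (64 * ((2 * M + 2) * moment_bound t / e ^+ 3 + M / e)).
have lhs : (M - 1) * mean_exit n t @[n --> \oo] --> (M - 1) * mean_limit t.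
  by apply: cvgMr; exact: mean_exit_cvg.
have rhs : quad M be x y + (3 * M + 2) * e + del n * Q @[n --> \oo] -->
    quad M be x y + (3 * M + 2) * e + 0 * Q.
  by apply: cvgD; [exact: cvg_cst|apply: cvgMl; exact: del_cvg0].
rewrite mul0r addr0 in rhs.
by apply: (ler_cvg_to lhs rhs); apply: nearW => n; exact: mean_exit_le.
Qed.

Lemma mean_limit_ge s t L : 0 < L -> (s <= t)%N -> (0 < t)%N ->
  quad M be x y - ((`|M * be| + 2 * L) * (mean_limit t / t%:R)
    + 2 * moment_bound s / L + 2 * (mean_limit t - mean_limit s)) <=
  (M - 1) * mean_limit t.
Proof.
move=> L0 st t0.
have ct := @mean_exit_cvg t; have cs := @mean_exit_cvg s.
have rhs : (M - 1) * mean_exit n t @[n --> \oo] --> (M - 1) * mean_limit t.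
  by apply: cvgMr; exact: mean_exit_cvg.
apply: (ler_cvg_to _ rhs); last first.
  by apply: nearW => n; exact: (mean_exit_ge n L0 st t0).
apply: cvgB; first exact: cvg_cst.
apply: cvgD; last by apply: cvgMr; exact: cvgB.
apply: cvgD; last exact: cvg_cst.
by apply: cvgMr; apply: cvgMl.
Qed.

(** In [mean_limit_ge], first take [s] for which the mean limit is almost its
supremum, which bounds the last term uniformly in [t]; then choose [L] large for
the second term; then [t] large for the first one. *)
Lemma mean_limit_sup e : 0 < e -> 0 <= quad M be x y ->
  exists t, quad M be x y - e <= (M - 1) * mean_limit t.
Proof.
move=> e0 q0; set q := quad M be x y in q0 *.
have M1 : 0 < M - 1 by rewrite subr_gt0.
have ub t : mean_limit t <= q / (M - 1).
  by rewrite ler_pdivlMr // mulrC; exact: mean_limit_le.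
have hs : has_sup (range mean_limit).
  split; first by exists (mean_limit 0%N), 0%N.
  by exists (q / (M - 1)) => _ [t _ <-]; exact: ub.
have [_ [s _ <-] hS] := sup_adherent (divr_gt0 e0 (ltr0Sn R 7)) hs.
have sup_ub t : mean_limit t <= sup (range mean_limit).
  by apply: ub_le_sup; [case: hs|exists t].
set L := 8 * moment_bound s / e + 1.
have L0 : 0 < L.
  by rewrite ltr_wpDl // divr_ge0 ?(ltW e0) // mulr_ge0 // moment_bound_ge0.
have LE : 2 * moment_bound s / L <= e / 4.
  rewrite ler_pdivrMr //; have : L * e = 8 * moment_bound s + e.
    by rewrite /L mulrDl mul1r divfK // gt_eqF.
  lra.
set c := `|M * be| + 2 * L; set k := c * (q / (M - 1)).
have c0 : 0 <= c by rewrite addr_ge0 // mulr_ge0 // ltW.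
have k0 : 0 <= k by rewrite mulr_ge0 // divr_ge0 // ltW.
pose t := (maxn s (Num.bound (4 * k / e))).+1.
have st : (s <= t)%N by rewrite leqW // leq_maxl.
have t0 : (0 < t)%N by [].
have tR : 0 < t%:R :> R by rewrite ltr0n.
exists t; have := mean_limit_ge L0 st t0; rewrite -/q -/c.
have h1 : c * (mean_limit t / t%:R) <= e / 4.
  rewrite mulrA ler_pdivrMr //; apply: (@le_trans _ _ k).
    by apply: ler_wpM2l => //; exact: ub.
  have : 4 * k / e <= t%:R.
    apply: le_trans (ltW (archi_boundP _)) _.
      by rewrite divr_ge0 ?(ltW e0) // mulr_ge0.
    by rewrite ler_nat leqW // leq_max leqnn orbT.
  by rewrite ler_pdivrMr //; lra.
have := sup_ub t.
lra.
Qed.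

End DyadicExit.

(** * Comparison with the exit time of the Brownian path *)
Section Pathwise.
Context (T : Type) (R : realType).
Implicit Types (W : R -> T -> R * R) (D : set (R * R)).

Lemma exit_time_ge0 W D w : (0 <= exit_time W D w)%E.
Proof. by apply: le_ereal_inf_tmp => _ [r [r0 _] <-]; rewrite lee_fin. Qed.

Lemma exit_time_le W D w (r : R) : 0 <= r -> ~ D (W r w) ->
  (exit_time W D w <= r%:E)%E.
Proof. by move=> r0 nD; apply: ereal_inf_lbound; exists r. Qed.

Lemma hyperbolic_regionE (m b : R) z : m != 0 ->
  hyperbolic_region m b z <-> 0 < quad (m ^+ 2) (b ^+ 2) z.1 z.2.
Proof.
move=> m0; have m2 : 0 < m ^+ 2 by rewrite exprn_even_gt0.
rewrite /hyperbolic_region /= -subr_gt0 -(pmulr_rgt0 _ m2).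
rewrite (_ : m ^+ 2 * _ = quad (m ^+ 2) (b ^+ 2) z.1 z.2) //.
by rewrite /quad; field.
Qed.

End Pathwise.

(** The integral of a nonnegative function is a supremum over the simple functions
below it, hence monotone without measurability, which the exit time may lack. *)
Lemma ge0_le_integral_unmeasurable d (T : measurableType d) (R : realType)
    (mu : {measure set T -> \bar R}) (f g : T -> \bar R) :
  (forall x, 0 <= f x)%E -> (forall x, f x <= g x)%E ->
  (\int[mu]_x f x <= \int[mu]_x g x)%E.
Proof.
move=> f0 fg; have g0 x : (0 <= g x)%E by exact: le_trans (fg x).
rewrite !ge0_integralTE //; apply: ereal_sup_le => _ [h hf <-]; exists h => // x.
exact: le_trans (hf x) (fg x).
Qed.

Section ExitTime.
Context d (T : measurableType d) (R : realType) (P : probability T R).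
Variables (m b x y : R) (W : R -> T -> R * R).
Hypothesis m_gt1 : 1 < m.
Hypothesis W_bm : planar_brownian_motion P (x, y) W.
Hypothesis xy_in : hyperbolic_region m b (x, y).

Local Notation B1 := (fun t w => (W t w).1).
Local Notation B2 := (fun t w => (W t w).2).
Local Notation M := (m ^+ 2).
Local Notation tau := (exit_time W (hyperbolic_region m b)).
Local Notation q be := (quad M be x y).

Let bm1 : brownian_motion P x B1 := pbm_fst W_bm.
Let bm2 : brownian_motion P y B2 := pbm_snd W_bm.
Let ind : independent_processes P B1 B2 := pbm_indep W_bm.

Let m_neq0 : m != 0. Proof. by rewrite gt_eqF // (lt_trans ltr01). Qed.

Let M_gt1 : 1 < M.
Proof. by rewrite -(expr1n _ 2) ltrXn2r // ?nnegrE // ltW // (lt_trans ltr01). Qed.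

Definition good_path (w : T) : Prop :=
  [/\ W 0 w = (x, y),
    {within [set t : R | 0 <= t], continuous (fun t => (W t w).1)} &
    {within [set t : R | 0 <= t], continuous (fun t => (W t w).2)}].

Lemma ae_good_path : {ae P, forall w, good_path w}.
Proof.
have s1 := bm_start bm1; have s2 := bm_start bm2.
have c1 := bm_continuous bm1; have c2 := bm_continuous bm2.
apply: filterS (filterI (filterI s1 s2) (filterI c1 c2)) => w [[e1 e2] [k1 k2]].
by split=> //; rewrite [W 0 w]surjective_pairing e1 e2.
Qed.

Lemma recentered_good w r : good_path w ->
  recentered x B1 r w = (W r w).1 /\ recentered y B2 r w = (W r w).2.
Proof. by move=> [W0 _ _]; rewrite /recentered W0 /=; split; ring. Qed.

Local Notation Survives := (survives x y B1 B2 M).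
Local Notation GridTime := (grid_time x y B1 B2 M).
Local Notation ExitLimit := (exit_limit x y B1 B2 M).

Lemma survives_anti be n i j : (i <= j)%N -> Survives be n j `<=` Survives be n i.
Proof. exact: alive_anti. Qed.

Lemma grid_time_dead be n k t w : ~ Survives be n k w ->
  GridTime be n t w <= k%:R * del R n.
Proof.
move=> nk; have [tk|kt] := leqP (grid t n) k.
  apply: le_trans (grid_time_le _ _ _ _ _ _ _ _ _) _.
  by rewrite -(grid_del R t n) ler_pM2r ?del_gt0 // ler_nat.
rewrite /grid_time (@big_cat_nat _ _ _ k 0 (grid t n)) ?(ltnW kt) //=.
rewrite [X in _ + X]big1_seq ?addr0; last first.
  move=> i; rewrite mem_index_iota => /andP[_ /andP[ki _]].
  by rewrite indicE memNset ?mulr0 // => /(survives_anti ki).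
rewrite big_mkord mulr_natl -[k in _ *+ k]card_ord -sumr_const; apply: ler_sum => i _.
by rewrite ler_piMr // ltW // del_gt0.
Qed.

Lemma grid_time_alive be n k t w : (k <= grid t n)%N ->
  (forall i, (i < k)%N -> Survives be n i w) -> k%:R * del R n <= GridTime be n t w.
Proof.
move=> kt al; rewrite /grid_time (@big_cat_nat _ _ _ k 0 (grid t n)) //=.
rewrite (eq_big_nat _ _ (F2 := fun=> del R n)); last first.
  by move=> i /andP[_ ik]; rewrite indicE mem_set ?mulr1 //; exact: al.
rewrite big_const_nat subn0 iter_addr addr0 mulr_natl lerDl.
apply: sumr_ge0 => i _; apply: mulr_ge0; first exact/ltW/del_gt0.
by case: (indic_01 R (Survives be n i) w) => ->.
Qed.

(** The first grid time at which the path is seen outside is an exit time. *)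
Lemma exit_time_le_grid n t w : good_path w ->
  (mine (tau w) t%:R%:E <= (GridTime (b ^+ 2) n t w)%:E)%E.
Proof.
move=> gw; set be := b ^+ 2.
have [al|] := pselect (forall i, (i < grid t n)%N -> Survives be n i w).
  rewrite ge_min; apply/orP; right.
  by rewrite lee_fin -(grid_del R t n); exact: grid_time_alive.
move=> /existsNP[k0 /not_implyP[k0t nk0]].
have ex : exists k, `[< ~ Survives be n k w >] by exists k0; apply/asboolP.
have [k /asboolP nk kmin] := ex_minnP ex.
have kt : (k <= grid t n)%N.
  by apply: leq_trans (ltnW k0t); apply: kmin; exact/asboolP.
rewrite ge_min; apply/orP; left.
apply: (@le_trans _ _ (k%:R * del R n)%:E); last first.
  rewrite lee_fin; apply: grid_time_alive => // i ik; apply: contrapT => ni.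
  by have := kmin i; rewrite leqNgt ik => /(_ _)/negP; apply => //; exact/asboolP.
move: nk; rewrite survivesE => /existsNP[j /not_implyP[jk nj]].
have [e1 e2] := recentered_good (j%:R * del R n) gw.
apply: (@le_trans _ _ (j%:R * del R n)%:E); last first.
  by rewrite lee_fin ler_pM2r ?del_gt0 // ler_nat.
apply: exit_time_le; first by rewrite mulr_ge0 // ltW // del_gt0.
by move=> /(hyperbolic_regionE _ _ m_neq0); rewrite -e1 -e2.
Qed.

Lemma exit_limit_ge t w : good_path w ->
  (mine (tau w) t%:R%:E <= (ExitLimit (b ^+ 2) t w)%:E)%E.
Proof.
move=> gw; have h n := exit_time_le_grid n t gw.
have fin : mine (tau w) t%:R%:E \is a fin_num.
  rewrite ge0_fin_numE; last first.
    by rewrite le_min exit_time_ge0 lee_fin ler0n.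
  by rewrite gt_min ltry orbT.
rewrite -(fineK fin) lee_fin; apply: limr_ge; first exact: grid_time_cvg.
by apply: nearW => n; rewrite -lee_fin fineK.
Qed.

(** At a time when the path is outside the region of parameter [b ^ 2], it is
strictly outside the region of parameter [be]; by continuity it stays so for a
while, and the first subsequent point of a fine grid sees it there.  With
[be = b ^ 2] the path could touch the boundary between grid times and return. *)
Lemma exit_limit_le_exit be t w : be < b ^+ 2 -> good_path w ->
  ((ExitLimit be t w)%:E <= tau w)%E.
Proof.
move=> beb gw; apply: le_ereal_inf_tmp => _ [r [r0 nD] <-]; rewrite lee_fin.
have qb : quad M (b ^+ 2) (W r w).1 (W r w).2 <= 0.
  by rewrite leNgt; apply/negP => /(hyperbolic_regionE _ _ m_neq0).
have M0 : 0 < M by rewrite (lt_trans ltr01).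
have qr : quad M be (W r w).1 (W r w).2 < 0.
  apply: lt_le_trans qb; rewrite /quad !ltrD2r.
  by rewrite ltr_pM2l.
have [_ c1 c2] := gw.
have /subspace_continuousP/(_ r r0) k1 := c1.
have /subspace_continuousP/(_ r r0) k2 := c2.
have cq : quad M be (W s w).1 (W s w).2 @[s --> within [set t : R | 0 <= t] (nbhs r)]
    --> quad M be (W r w).1 (W r w).2.
  apply: cvgD; last exact: (cvgM k2 k2).
  by apply: cvgB; [exact: cvg_cst|apply: cvgMr; exact: (cvgM k1 k1)].
have /nbhs_ballP[h /= h0 hball] :
    nbhs r [set s | 0 <= s -> quad M be (W s w).1 (W s w).2 < 0].
  have near_neg := cvgr_lt _ cq _ qr; exact: near_neg.
apply/ler_addgt0Pr => e e0.
have he0 : 0 < Num.min h e by rewrite lt_min h0 e0.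
have [n dn] : exists n, del R n < Num.min h e.
  have /cvgr_lt/(_ _ he0) [n _ hn] := @del_cvg0 R.
  by exists n; apply: hn => /=.
move: dn; rewrite lt_min => /andP[dh de].
have d0 := del_gt0 R n.
have rd0 : 0 <= r / del R n by rewrite divr_ge0 // ltW.
have /andP[k1' k2'] := truncn_itv rd0.
(* The first grid point after r. *)
set k := (Num.truncn (r / del R n)).+1.
have rk : r < k%:R * del R n by rewrite -ltr_pdivrMr.
have kr : k%:R * del R n <= r + del R n.
  by rewrite /k -natr1 mulrDl mul1r lerD2r -ler_pdivlMr.
apply: (@le_trans _ _ (k%:R * del R n)); last by apply: le_trans kr _; rewrite lerD2l ltW.
apply: le_trans (exit_limit_le _ _ _ _ _ _ n _ _) _.
apply: grid_time_dead; rewrite survivesE => /(_ k (leqnn k)).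
have [-> ->] := recentered_good (k%:R * del R n) gw.
apply/negP; rewrite -leNgt ltW //; apply: hball; last by rewrite /= mulr_ge0 // ltW.
rewrite /ball /= ltr_distlC; apply/andP; split; lra.
Qed.

Local Notation MeanLimit := (mean_limit P x y B1 B2 M).

Let exit_limit_Ex be t : L1 P (ExitLimit be t) /\
  (\int[P]_w (ExitLimit be t w)%:E = (MeanLimit be t)%:E)%E.
Proof.
have l : L1 P (ExitLimit be t) by exact: (exit_limit_L1 _ _ _ _ bm1 bm2 ind).
by split=> //; rewrite ExE.
Qed.

Lemma exit_time_expectation_ge be t : be < b ^+ 2 ->
  ((MeanLimit be t)%:E <= \int[P]_w tau w)%E.
Proof.
move=> beb; have [l <-] := exit_limit_Ex be t.
have [N [mN PN gN]] := ae_good_path.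
have ml := L1_measurable l.
have mNc : measurable_fun [set: T] (\1_(~` N) : T -> R).
  by apply: measurable_indic; exact: measurableC.
rewrite (@ge0_ae_eq_integral _ _ _ P [set: T] _
  (fun w => (ExitLimit be t w * \1_(~` N) w)%:E)) //.
- apply: ge0_le_integral_unmeasurable => w.
    by rewrite lee_fin mulr_ge0 ?exit_limit_ge0.
  have [Nw|nNw] := pselect (N w).
    by rewrite indicE memNset ?mulr0 ?exit_time_ge0 //; exact.
  rewrite indicE mem_set // mulr1; apply: exit_limit_le_exit => //.
  by apply: contrapT => ngw; apply: nNw; exact: gN.
- exact/measurable_EFinP.
- by apply/measurable_EFinP; exact: measurable_funM.
- by move=> w _; rewrite lee_fin exit_limit_ge0.
- by move=> w _; rewrite lee_fin mulr_ge0 ?exit_limit_ge0.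
- exists N; split=> // w /= /not_implyP[_ neq]; apply: contrapT => nNw.
  by apply: neq; rewrite indicE mem_set // mulr1.
Qed.

Import HBNNSimple.

(** A simple function below the exit time is bounded, so it stays below the exit
time truncated at some [t]. *)
Lemma exit_time_expectation_le :
  (\int[P]_w tau w <= (q (b ^+ 2) / (M - 1))%:E)%E.
Proof.
have q0 : 0 < q (b ^+ 2) by apply/(hyperbolic_regionE b (x, y) m_neq0).
rewrite ge0_integralTE; last by move=> w; exact: exit_time_ge0.
apply: ge_ereal_sup => _ [h /= hle <-].
have [A [_ hA]] := simple_bounded h.
have hb w : h w <= (Num.bound (A + 1))%:R.
  have hA1 : `|h w| <= A + 1 by apply: (hA (A + 1)) => //; rewrite ltrDl.
  have A1 : 0 <= A + 1 := le_trans (normr_ge0 _) hA1.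
  by apply: le_trans (ler_norm _) (le_trans hA1 _); exact/ltW/archi_boundP.
set t := Num.bound (A + 1) in hb.
have [l lE] := exit_limit_Ex (b ^+ 2) t.
apply: (@le_trans _ _ (MeanLimit (b ^+ 2) t)%:E).
  rewrite -lE -integralT_nnsfun; apply: ae_ge0_le_integral => //.
  - by move=> w _; rewrite lee_fin.
  - by apply/measurable_EFinP.
  - by move=> w _; rewrite lee_fin exit_limit_ge0.
  - by apply/measurable_EFinP; exact: (L1_measurable l).
  - apply: filterS ae_good_path => w gw _; apply: le_trans (exit_limit_ge t gw).
    by rewrite le_min hle lee_fin hb.
rewrite lee_fin ler_pdivlMr ?subr_gt0 // mulrC.
by apply: (mean_limit_le bm1 bm2 ind M_gt1); exact: ltW.
Qed.

Lemma exit_time_expectation :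
  (\int[P]_w tau w = (q (b ^+ 2) / (M - 1))%:E)%E.
Proof.
have q0 : 0 < q (b ^+ 2) by apply/(hyperbolic_regionE b (x, y) m_neq0).
have M1 : 0 < M - 1 by rewrite subr_gt0.
have M0 : 0 < M by rewrite (lt_trans ltr01).
apply/eqP; rewrite eq_le exit_time_expectation_le /=.
apply/lee_addgt0Pr => e e0.
set a := Num.min (e / 2 * (M - 1)) (q (b ^+ 2)).
have a0 : 0 < a by rewrite lt_min q0 mulr_gt0 ?divr_gt0.
have ae : a <= e / 2 * (M - 1) by rewrite ge_min lexx.
have aq : a <= q (b ^+ 2) by rewrite ge_min lexx orbT.
(* The parameter that lowers quad by a, the loss also allowed for the mean limit. *)
set be := b ^+ 2 - a / M.
have beb : be < b ^+ 2 by rewrite gtrBl divr_gt0.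
have qE : q be = q (b ^+ 2) - a.
  by rewrite /quad /be mulrBr [M * (a / M)]mulrC divfK ?gt_eqF //; ring.
have qbe : 0 <= q be by rewrite qE subr_ge0.
have [t ht] := mean_limit_sup bm1 bm2 ind M_gt1 a0 qbe.
have := exit_time_expectation_ge t beb.
move=> /(leeD2r e%:E); apply: le_trans; rewrite -EFinD lee_fin.
rewrite ler_pdivrMr // mulrDl; move: ht; rewrite qE.
rewrite [(M - 1) * _]mulrC; lra.
Qed.

End ExitTime.

Unset Implicit Arguments.

Theorem lemma2p3 (R : realType) (m b : R) (hm : 1 < m) (hb : 0 < b)
    (x y : R) (hxy : hyperbolic_region m b (x, y))
    (d : measure_display) (T : measurableType d) (P : probability T R)
    (W : R -> T -> R * R) (hW : planar_brownian_motion P (x, y) W) :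
  (\int[P]_w exit_time W (hyperbolic_region m b) w)%E =
  ((m ^+ 2 * (b ^+ 2 - x ^+ 2) + y ^+ 2) / (m ^+ 2 - 1))%:E.
Proof.
rewrite (exit_time_expectation hm hW hxy); congr (_ / _)%:E.
by rewrite /quad mulrBr.
Qed.
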